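(* Consider an $M^{X}/G/1$ queue operating under the LCFS-p-repeat-without-resampling discipline, with Poisson batch arrivals of rate $\lambda$, i.i.d. batch sizes with mean $\mu$, i.i.d. service times distributed as $S$ (all independent), and stable, i.e. $E(e^{\lambda S})<(\mu+1)/\mu$. Let $X_0$ be the number of customers in the first batch of a busy period, $S_0$ the service requirement of the first customer to enter service in the busy period, $T_1$ the first interarrival time after the busy period starts, and $M$ the maximum number of customers in the system during a busy period. Let $M(k,s)$ and $M(k)$ denote random variables distributed as $M$ conditionally on $\{X_0=k,S_0=s\}$ and on $\{X_0=k\}$ respectively, and let $I(s)=1$ if $T_1<s$ and $I(s)=0$ otherwise. Then for $k\geq1$ and $s\geq 0$, $$M(k,s)=_d I(s)\max\{M+k;\,M(k,s)\}+(1-I(s))\max\{k,M(k-1)\},$$ where $M(0)=0$, and $I(s)$, $M$, $M(k,s)$ and $M(k-1)$ on the right-hand side are independent.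
   Context: Under LCFS-p-repeat-without-resampling, the customer who has been in the system the least amount of time is always served, newly arriving customers preempt the customer in service (customers within a batch are labeled arbitrarily and treated as arriving sequentially), service is non-idling, and a preempted service must be restarted from scratch when service recommences, but each customer's total service requirement is drawn only once and is the same each time it restarts. $Y=_dZ$ denotes equality in distribution. *)

(* Defs.v *)
From HB Require Import structures.
From mathcomp Require Import all_boot all_order all_algebra.
From mathcomp Require Import all_classical all_reals all_analysis measurable_realfun.
Set Implicit Arguments. Unset Strict Implicit. Unset Printing Implicit Defensive.
Import Order.TTheory GRing.Theory Num.Theory.
Local Open Scope classical_set_scope.
Local Open Scope ring_scope.

(* Sample-path dynamics of a busy period of the M^X/G/1 queue under    *)
(* LCFS-p-repeat-without-resampling.                                   *)
(* Inputs of a busy period (starting at time 0 with the arrival of     *)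
(* batch 0):                                                           *)
(*   A n     : interarrival time between batch n-1 and batch n (n>=1); *)
(*             A 1 = T_1 is the first interarrival time.               *)
(*   B n     : size of batch n (B 0 = X_0).                            *)
(*   sig n i : service requirement of the i-th customer of batch n;    *)
(*             customers of a batch are treated as arriving            *)
(*             sequentially, with customer 0 of the batch arriving     *)
(*             last, hence served first (so S_0 = sig 0 0).            *)
(* The state at event epochs is (stack, r, n): stack = list of the     *)
(* (full, never resampled) service requirements of the customers in    *)
(* the system, the head being in service (and having just started a    *)
(* fresh attempt, since every event either starts a new customer or    *)
(* restarts a preempted one from scratch); r = residual time until the *)
(* next batch arrival; n = index of the next batch to arrive.          *)
(* If the head's requirement tau <= r, the head completes (tie         *)
(* resolved as completion, consistent with I(s)=1{T_1<s}); otherwise   *)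
(* batch n arrives after time r, preempts, and is pushed on the stack. *)
(* Once the stack is empty the busy period is over (state frozen).     *)

Section Dynamics.
Variable R : realType.

Definition qstate := (seq R * R * nat)%type.

Definition push_batch (B : nat -> nat) (sig : nat -> nat -> R) (n : nat)
  : seq R := [seq sig n i | i <- iota 0 (B n)].

Definition step (A : nat -> R) (B : nat -> nat) (sig : nat -> nat -> R)
  (st : qstate) : qstate :=
  let: (stk, r, n) := st in
  match stk with
  | [::] => st
  | tau :: rest =>
      if tau <= r then (rest, r - tau, n)
      else (push_batch B sig n ++ stk, A n.+1, n.+1)
  end.

Definition init_state (A : nat -> R) (B : nat -> nat) (sig : nat -> nat -> R)
  : qstate := (push_batch B sig 0, A 1%N, 1%N).

Definition nsys (A : nat -> R) (B : nat -> nat) (sig : nat -> nat -> R)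
  (j : nat) : nat :=
  size (iter j (step A B sig) (init_state A B sig)).1.1.

(* maximum number of customers in the system during the busy period
   (the number in system only increases at event epochs) *)
Definition busy_max (A : nat -> R) (B : nat -> nat) (sig : nat -> nat -> R)
  : \bar R :=
  ereal_sup [set ((nsys A B sig j)%:R)%:E | j in [set: nat]].

(* conditioning on X_0 = k (and S_0 = s) by substitution *)
Definition setB0 (B : nat -> nat) (k : nat) : nat -> nat :=
  fun n => if n == 0%N then k else B n.

Definition setS0 (sig : nat -> nat -> R) (s : R) : nat -> nat -> R :=
  fun n i => if (n == 0%N) && (i == 0%N) then s else sig n i.

End Dynamics.

Section RandomVars.
Variables (d : measure_display) (Omega : measurableType d) (R : realType).

Definition Mrv (T : nat -> Omega -> R) (B : nat -> Omega -> nat)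
  (sig : nat -> nat -> Omega -> R) : Omega -> \bar R :=
  fun w => busy_max (fun n => T n w) (fun n => B n w) (fun n i => sig n i w).

Definition Mk_rv (T : nat -> Omega -> R) (B : nat -> Omega -> nat)
  (sig : nat -> nat -> Omega -> R) (k : nat) : Omega -> \bar R :=
  fun w => busy_max (fun n => T n w) (setB0 (fun n => B n w) k)
                    (fun n i => sig n i w).

Definition Mks_rv (T : nat -> Omega -> R) (B : nat -> Omega -> nat)
  (sig : nat -> nat -> Omega -> R) (k : nat) (s : R) : Omega -> \bar R :=
  fun w => busy_max (fun n => T n w) (setB0 (fun n => B n w) k)
                    (setS0 (fun n i => sig n i w) s).
End RandomVars.

Definition mutually_independent {d : measure_display} {Omega : measurableType d}
  {R : realType} (P : probability Omega R) {I : eqType}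
  {dV : measure_display} {V : measurableType dV} (X : I -> Omega -> V) : Prop :=
  forall (J : seq I) (A : I -> set V), uniq J -> (forall i, measurable (A i)) ->
    P [set w | forall i, i \in J -> A i (X i w)] =
    (\prod_(i <- J) P (X i @^-1` A i))%E.

Definition eqdist {d1 d2 : measure_display} {O1 : measurableType d1}
  {O2 : measurableType d2} {R : realType} {dV : measure_display}
  {V : measurableType dV}
  (P1 : probability O1 R) (X1 : O1 -> V)
  (P2 : probability O2 R) (X2 : O2 -> V) : Prop :=
  forall A : set V, measurable A -> P1 (X1 @^-1` A) = P2 (X2 @^-1` A).

(* index type of the primitive inputs: IT n stands for T (n+1) *)
Inductive input_idx := IT of nat | IB of nat | IS of nat & nat.

Definition input_idx_code (x : input_idx) : nat + nat + (nat * nat) :=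
  match x with IT n => inl (inl n) | IB n => inl (inr n) | IS n i => inr (n, i) end.
Definition input_idx_decode (y : nat + nat + (nat * nat)) : input_idx :=
  match y with inl (inl n) => IT n | inl (inr n) => IB n | inr (n, i) => IS n i end.
Lemma input_idx_codeK : cancel input_idx_code input_idx_decode.
Proof. by case. Qed.
HB.instance Definition _ := Equality.copy input_idx (can_type input_idx_codeK).

Definition inputs {d : measure_display} {Omega : measurableType d} {R : realType}
  (T : nat -> Omega -> R) (B : nat -> Omega -> nat)
  (sig : nat -> nat -> Omega -> R) : input_idx -> Omega -> R :=
  fun x => match x with
           | IT n => T n.+1 | IB n => fun w => (B n w)%:R | IS n i => sig n i end.

(* Main.v *)
Require Import Defs.
From HB Require Import structures.
From mathcomp Require Import all_boot all_order all_algebra.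
From mathcomp Require Import ring lra.
From mathcomp Require Import all_classical all_reals all_analysis measurable_realfun.
Import Order.TTheory GRing.Theory Num.Theory.
Local Open Scope classical_set_scope.
Local Open Scope ring_scope.

(* Let [u a stk] be the probability that the number in system never exceeds [a] when the
   customers in [stk] are present and the time to the next arrival is a fresh exponential
   variable. By memorylessness
     u a (tau :: c) = e^(-lam tau) u a c + (1 - e^(-lam tau)) E[u a (batch ++ tau :: c)]
   as long as [size (tau :: c) <= a], and [u a (tau :: c) = 0] otherwise. Stability provides
   a [K] such that the weight v tau = e^(lam tau) (1 + K) - K of a customer satisfies
   E[sum of v over a batch] = K (K is the mean number of events caused by a batch); the
   total weight of the stack then decreases by one on average at every event, so that
   bounded solutions of the equation are determined by their value at the empty stack.
   Since [c |-> u a (c ++ b)] and [c |-> u (a - size b) c * u a b] solve the same equation,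
   they coincide. Substituting this for [c] the interrupting batch and averaging over the
   waiting customers gives the identity of the theorem for all distribution functions. *)

(** * Independence *)

Section independence.
Context {R : realType}.
Local Open Scope ereal_scope.

(** Dynkin's pi-lambda argument: the sets on which both measures agree contain the pi-system and are
    closed under complements and countable disjoint unions. Finiteness allows the subtraction in the
    complement step. *)
Lemma finite_measure_ext {d} {V : measurableType d} (G : set (set V))
    (m1 m2 : {measure set V -> \bar R}) :
  @measurable _ V = <<s G >> -> setI_closed G ->
  m1 setT < +oo -> m1 setT = m2 setT -> (forall A, G A -> m1 A = m2 A) ->
  forall A, measurable A -> m1 A = m2 A.
Proof.
move=> GE GI fin1 m12T m12 A mA.
have : <<s G >> A by rewrite -GE.
move: A {mA}; apply: (@dynkin_induction _ _ G (fun A => m1 A = m2 A)) => //.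
- move=> S mS m12S.
  have TS : ~` S = setT `\` S by rewrite setTD.
  have fin2 : m2 setT < +oo by rewrite -m12T.
  rewrite TS measureD// [RHS]measureD// !setTI.
  by congr (_ - _).
- move=> F mF tF m12F.
  have mU : measurable (\bigcup_k F k) by exact: bigcupT_measurable.
  rewrite !measure_bigcup//; apply: eq_eseriesr => i _; exact: m12F.
Qed.

Lemma law_measure {d d1} {O : measurableType d} {V : measurableType d1}
    (m : {measure set O -> \bar R}) (X : O -> V) : measurable_fun setT X ->
  exists l : {measure set V -> \bar R}, forall A, l A = m (X @^-1` A).
Proof.
move=> mX.
by unshelve refine (ex_intro _ (pushforward m X : {measure set V -> \bar R}) _).
Qed.

Lemma eqdist_ext {d1 d2 d} {O1 : measurableType d1} {O2 : measurableType d2}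
    {V : measurableType d} (P1 : probability O1 R) (X1 : O1 -> V)
    (P2 : probability O2 R) (X2 : O2 -> V) (G : set (set V)) :
  @measurable _ V = <<s G >> -> setI_closed G ->
  measurable_fun setT X1 -> measurable_fun setT X2 ->
  (forall A, G A -> P1 (X1 @^-1` A) = P2 (X2 @^-1` A)) ->
  eqdist P1 X1 P2 X2.
Proof.
move=> GE GI mX1 mX2 H A mA.
have [m1 m1E] := law_measure P1 X1 mX1; have [m2 m2E] := law_measure P2 X2 mX2.
have m1T : m1 setT = 1 by rewrite m1E preimage_setT; exact: probability_setT.
have m2T : m2 setT = 1 by rewrite m2E preimage_setT; exact: probability_setT.
rewrite -m1E -m2E; apply: (finite_measure_ext _ m1 m2 GE GI) => //.
- by rewrite m1T ltry.
- by rewrite m1T.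
- by move=> B GB; rewrite m1E m2E; exact: H.
Qed.

Definition independent2 {d d1 d2} {O : measurableType d} {V1 : measurableType d1}
    {V2 : measurableType d2} (P : probability O R) (Y1 : O -> V1) (Y2 : O -> V2) :=
  forall A1 A2, measurable A1 -> measurable A2 ->
    P (Y1 @^-1` A1 `&` Y2 @^-1` A2) = P (Y1 @^-1` A1) * P (Y2 @^-1` A2).

Lemma independent2C {d d1 d2} {O : measurableType d} {V1 : measurableType d1}
    {V2 : measurableType d2} (P : probability O R) (Y1 : O -> V1) (Y2 : O -> V2) :
  independent2 P Y1 Y2 -> independent2 P Y2 Y1.
Proof. by move=> H A1 A2 m1 m2; rewrite setIC muleC H. Qed.

Lemma preimage_measurable {d d1} {O : measurableType d} {V1 : measurableType d1}
  (Y1 : O -> V1) A : measurable_fun setT Y1 -> measurable A -> measurable (Y1 @^-1` A).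
Proof. by move=> mY mA; rewrite -[X in measurable X]setTI; exact: mY. Qed.

(** For a fixed event [H] both sides are finite measures in [A]: the law of [Y] under [P] restricted
    to [H], and the law of [Y] scaled by [P H]. Comparing them on a generating pi-system
    suffices. *)
Lemma independent_event_ext {d d1} {O : measurableType d} {V : measurableType d1}
    (P : probability O R) (Y : O -> V) (H : set O) (G : set (set V)) :
  @measurable _ V = <<s G >> -> setI_closed G ->
  measurable_fun setT Y -> measurable H ->
  (forall A, G A -> P (H `&` Y @^-1` A) = P H * P (Y @^-1` A)) ->
  forall A, measurable A -> P (H `&` Y @^-1` A) = P H * P (Y @^-1` A).
Proof.
move=> GE GI mY mH HG A mA.
have PH0 : (0 <= fine (P H))%R by rewrite fine_ge0.
have PHE : P H = (fine (P H))%:E by rewrite fineK// fin_num_measure.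
have [m1 m1E'] := law_measure (mrestr P mH) Y mY.
have m1E B : m1 B = P (H `&` Y @^-1` B) by rewrite m1E' /mrestr/= setIC.
have [m2' m2E'] := law_measure P Y mY.
pose m2 : {measure set V -> \bar R} := mscale (NngNum PH0) m2'.
have m2E B : m2 B = P H * P (Y @^-1` B) by rewrite /m2/= /mscale/= -PHE m2E'.
rewrite -m1E -m2E; apply: (finite_measure_ext _ m1 m2 GE GI) => //.
- by rewrite m1E preimage_setT setIT -ge0_fin_numE ?fin_num_measure.
- by rewrite m1E m2E preimage_setT setIT probability_setT mule1.
- by move=> B GB; rewrite m1E m2E HG.
Qed.

(** The product formula passes from generators to all measurable sets one coordinate at a time, the
    other coordinate supplying the fixed event. *)
Lemma independent2_ext {d d1 d2} {O : measurableType d} {V1 : measurableType d1}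
    {V2 : measurableType d2} (P : probability O R) (Y1 : O -> V1) (Y2 : O -> V2)
    (G1 : set (set V1)) (G2 : set (set V2)) :
  @measurable _ V1 = <<s G1 >> -> setI_closed G1 ->
  @measurable _ V2 = <<s G2 >> -> setI_closed G2 ->
  measurable_fun setT Y1 -> measurable_fun setT Y2 ->
  (forall A1 A2, G1 A1 -> G2 A2 ->
    P (Y1 @^-1` A1 `&` Y2 @^-1` A2) = P (Y1 @^-1` A1) * P (Y2 @^-1` A2)) ->
  independent2 P Y1 Y2.
Proof.
move=> E1 I1 E2 I2 mY1 mY2 H A1 A2 mA1 mA2.
apply: (independent_event_ext _ _ _ _ E2 I2) => //.
  exact: preimage_measurable.
move=> B2 GB2.
have mB2 : measurable B2 by rewrite E2; exact: sub_gen_smallest.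
rewrite setIC muleC; apply: (independent_event_ext _ _ _ _ E1 I1) => //.
  exact: preimage_measurable.
by move=> B1 GB1; rewrite setIC muleC H.
Qed.

Lemma independent2_comp {d d1 d2 d3 d4} {O : measurableType d}
    {V1 : measurableType d1} {V2 : measurableType d2} {W1 : measurableType d3}
    {W2 : measurableType d4} (P : probability O R) (Y1 : O -> V1) (Y2 : O -> V2)
    (f1 : V1 -> W1) (f2 : V2 -> W2) :
  measurable_fun setT f1 -> measurable_fun setT f2 ->
  independent2 P Y1 Y2 -> independent2 P (f1 \o Y1) (f2 \o Y2).
Proof.
move=> m1 m2 H A1 A2 mA1 mA2.
by apply: (H (f1 @^-1` A1) (f2 @^-1` A2)); exact: preimage_measurable.
Qed.

Lemma measurable_section_prob {d d1 d2} {O : measurableType d}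
    {V1 : measurableType d1} {V2 : measurableType d2} (P : probability O R)
    (Y2 : O -> V2) (E : set (V1 * V2)) :
  measurable_fun setT Y2 -> measurable E ->
  measurable_fun setT (fun v => P [set w | E (v, Y2 w)]).
Proof.
move=> mY2 mE.
pose Z : {mfun O >-> V2} := HB.pack Y2 (isMeasurableFun.Build _ _ _ _ _ mY2).
have := measurable_fun_xsection (distribution P Z) mE.
apply: eq_measurable_fun => v _ /=; rewrite /distribution /pushforward.
by congr (P _); apply/seteqP; split => w /=; rewrite xsectionP.
Qed.

(* Under independence, the diagonal may be replaced by a product of two copies of
   the probability space. *)
Lemma independent2_ge0_integral {d d1 d2} {O : measurableType d} {V1 : measurableType d1}
    {V2 : measurableType d2} (P : probability O R)
    (Y1 : O -> V1) (Y2 : O -> V2)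
    (g : V1 * V2 -> \bar R) :
  measurable_fun setT Y1 -> measurable_fun setT Y2 -> independent2 P Y1 Y2 ->
  measurable_fun setT g -> (forall v, 0 <= g v) ->
  \int[P]_w g (Y1 w, Y2 w) = \int[P]_w \int[P]_w' g (Y1 w, Y2 w').
Proof.
move=> mY1 mY2 ind mg g0.
pose Z1 : {mfun O >-> V1} := HB.pack Y1 (isMeasurableFun.Build _ _ _ _ _ mY1).
pose Z2 : {mfun O >-> V2} := HB.pack Y2 (isMeasurableFun.Build _ _ _ _ _ mY2).
pose Y := fun w => (Y1 w, Y2 w).
have mY : measurable_fun setT Y by exact: measurable_fun_pair.
pose Z : {mfun O >-> (V1 * V2)%type} :=
  HB.pack Y (isMeasurableFun.Build _ _ _ _ _ mY).
have lawZ E : measurable E ->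
    (distribution P Z1 \x distribution P Z2) E = distribution P Z E.
  by move=> mE; apply: product_measure_unique => //; exact: ind.
transitivity (\int[distribution P Z]_v g v).
  by rewrite ge0_integral_distribution.
transitivity (\int[distribution P Z1 \x distribution P Z2]_v g v).
  by apply: eq_measure_integral => E mE _; exact/esym/lawZ.
rewrite fubini_tonelli1// /fubini_F ge0_integral_distribution//; last 2 first.
- exact: measurable_fun_fubini_tonelli_F.
- by move=> v; exact: integral_ge0.
apply: eq_integral => w _ /=; rewrite ge0_integral_distribution//.
exact: measurableT_comp.
Qed.


(** The product formula for integrals, applied to the indicator of [E]: freeze the first variable
    and average over an independent copy of the second. *)
Lemma independent2_integral {d d1 d2} {O : measurableType d}
    {V1 : measurableType d1} {V2 : measurableType d2} (P : probability O R)
    (Y1 : O -> V1) (Y2 : O -> V2) (E : set (V1 * V2)) :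
  measurable_fun setT Y1 -> measurable_fun setT Y2 ->
  independent2 P Y1 Y2 -> measurable E ->
  P [set w | E (Y1 w, Y2 w)] = \int[P]_w P [set w' | E (Y1 w, Y2 w')].
Proof.
move=> mY1 mY2 ind mE.
have intE (Y : O -> V1 * V2) : measurable_fun setT Y ->
    \int[P]_w (\1_E (Y w))%:E = P [set w | E (Y w)].
  move=> mY; have mYE : measurable (Y @^-1` E) by exact: preimage_measurable.
  by rewrite -[RHS]/(P (Y @^-1` E)) -(setIT (Y @^-1` E)) -integral_indic.
rewrite -(intE (fun w => (Y1 w, Y2 w))); last exact: measurable_fun_pair.
rewrite (independent2_ge0_integral P Y1 Y2 (fun v => (\1_E v)%:E))//; last first.
  exact/measurable_EFinP.
apply: eq_integral => w _; rewrite (intE (fun w' => (Y1 w, Y2 w')))//.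
exact: measurable_fun_pair.
Qed.

End independence.

(** * Countable families of real random variables *)

(** Finite-dimensional cylinders, in the shape of the events of [mutually_independent], so that
    independence gives their probability directly. *)
Definition cylinder (I : eqType) (R : realType) : set (set (I -> R)) :=
  [set C | exists (J : seq I) (A : I -> set R), [/\ uniq J,
    (forall i, measurable (A i)) & C = [set x | forall i, i \in J -> A i (x i)]]].

(** An alias of the function type, made to carry the product sigma-algebra generated by the
    cylinders. *)
Definition paths (I : eqType) (R : realType) : Type := I -> R.

Section paths_measurable.
Variables (I : eqType) (R : realType).
HB.instance Definition _ := gen_eqMixin (paths I R).
HB.instance Definition _ := gen_choiceMixin (paths I R).
HB.instance Definition _ := isPointed.Build (paths I R) (fun=> 0).
HB.instance Definition _ := @isMeasurable.Build (sigma_display (cylinder I R))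
  (paths I R) <<s cylinder I R >> (@sigma_algebra0 _ setT _)
  (@sigma_algebraC (paths I R) _)
  (@sigma_algebra_bigcup _ setT _).
End paths_measurable.

Section paths.
Context {R : realType}.
Implicit Type I : eqType.

Lemma cylinder_setI I : setI_closed (cylinder I R).
Proof.
move=> _ _ [J [A [uJ mA ->]]] [K [B [uK mB ->]]].
exists (undup (J ++ K)).
(* Sides outside each index list are filled with [setT], so that both cylinders live on the union of
   the two lists. *)
exists (fun i => (if i \in J then A i else setT) `&` (if i \in K then B i else setT)).
split; first exact: undup_uniq.
- by move=> i; apply: measurableI; case: ifP.
- apply/seteqP; split => [x [/= xA xB] i _|x /= H].
    by split; case: ifP => // ?; [exact: xA|exact: xB].
  split=> i iJ.
    by have := H i; rewrite mem_undup mem_cat iJ => -[].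
  by have := H i; rewrite mem_undup mem_cat iJ orbT => -[].
Qed.

Lemma measurable_coord {I} (i : I) : measurable_fun setT (fun x : paths I R => x i).
Proof.
move=> _ A mA; rewrite setTI; apply: sub_sigma_algebra.
exists [:: i], (fun _ => A); split => //.
by apply/seteqP; split => x /= => [? j /[!inE]/eqP ->|] => // /(_ i); apply; rewrite inE.
Qed.

Lemma measurable_fun_paths {I} {d} {O : measurableType d} (f : O -> paths I R) :
  (forall i, measurable_fun setT (fun w => f w i)) -> measurable_fun setT f.
Proof.
move=> mf; apply: (measurability (rT := paths I R) (cylinder I R)) => //.
move=> _ [_ [J [A [_ mA ->]]] <-].
rewrite setTI.
elim: J => [|j J IH]; first by rewrite (_ : _ @^-1` _ = setT)//; exact/seteqP.
rewrite (_ : _ @^-1` _ = (fun w => f w j) @^-1` A j `&`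
    f @^-1` [set x | forall i, i \in J -> A i (x i)]); last first.
  apply/seteqP; split => w /= => [h|[hj h] i].
    by split => [|i iJ]; apply: h; rewrite inE ?eqxx// iJ orbT.
  by rewrite inE => /orP[/eqP ->//|]; exact: h.
by apply: measurableI => //; exact: preimage_measurable.
Qed.

Lemma mutually_independent_reindex {I1 I2 : eqType} {d} {O : measurableType d}
    {d'} {V : measurableType d'} (P : probability O R) (X : I2 -> O -> V)
    (s : I1 -> I2) :
  injective s -> mutually_independent P X ->
  mutually_independent P (fun i => X (s i)).
Proof.
move=> si H J A uJ mA.
(* [A'] transports [A] along [s]; off the range of [s] the condition is void and [A' j] is
   [setT]. *)
pose A' j := [set r | forall i, s i = j -> A i r].
have A's i : A' (s i) = A i.
  by apply/seteqP; split => r /= h => [|k /si ->//]; exact: h.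
have mA' j : measurable (A' j).
  have [[i <-]|nj] := pselect (exists i, s i = j); first by rewrite A's.
  rewrite (_ : A' j = setT)//; apply/seteqP; split => // r _ i ij.
  by case: nj; exists i.
have := H (map s J) A'; rewrite map_inj_uniq// => /(_ uJ mA').
rewrite big_map; under eq_bigr do rewrite A's; move=> <-.
congr (P _); apply/seteqP; split => w /= h.
  by move=> _ /mapP[i iJ ->]; rewrite A's; exact: h.
by move=> i iJ; rewrite -A's; apply: h; rewrite map_f.
Qed.

(** On a cylinder both probabilities are products of marginal ones, so the marginals of an
    independent family determine its joint law. *)
Lemma eqdist_paths {I} {d1 d2} {O1 : measurableType d1} {O2 : measurableType d2}
    (P1 : probability O1 R) (P2 : probability O2 R)
    (X1 : I -> O1 -> R) (X2 : I -> O2 -> R) :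
  (forall i, measurable_fun setT (X1 i)) -> (forall i, measurable_fun setT (X2 i)) ->
  mutually_independent P1 X1 -> mutually_independent P2 X2 ->
  (forall i A, measurable A -> P1 (X1 i @^-1` A) = P2 (X2 i @^-1` A)) ->
  eqdist P1 (fun w => X1 ^~ w : paths I R) P2 (fun w => X2 ^~ w : paths I R).
Proof.
move=> mX1 mX2 i1 i2 H.
apply: (eqdist_ext (V := paths I R) _ _ _ _ (cylinder I R)) => //.
- exact: cylinder_setI.
- exact: measurable_fun_paths.
- exact: measurable_fun_paths.
- move=> _ [J [A [uJ mA ->]]].
  rewrite (_ : P1 _ = P1 [set w | forall i, i \in J -> A i (X1 i w)])//.
  rewrite (_ : P2 _ = P2 [set w | forall i, i \in J -> A i (X2 i w)])//.
  by rewrite i1// i2//; apply: eq_bigr => i _; exact: H.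
Qed.

(** A cylinder in each group gives one cylinder over the disjoint union of the index lists, and its
    product formula splits into two factors. *)
Lemma independent2_groups {I1 I2 : eqType} {d} {O : measurableType d}
    (P : probability O R) (X : I1 + I2 -> O -> R) :
  (forall i, measurable_fun setT (X i)) -> mutually_independent P X ->
  independent2 P (fun w => (fun i => X (inl i) w) : paths I1 R)
                 (fun w => (fun i => X (inr i) w) : paths I2 R).
Proof.
move=> mX iX.
apply: (independent2_ext (V1 := paths I1 R) (V2 := paths I2 R)
  _ _ _ (cylinder I1 R) (cylinder I2 R)) => //;
  [exact: cylinder_setI|exact: cylinder_setI|exact: measurable_fun_paths|
   exact: measurable_fun_paths|].
move=> _ _ [J [A [uJ mA ->]]] [K [B [uK mB ->]]].
have inlI : injective (@inl I1 I2) by move=> ? ? [].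
have inrI : injective (@inr I1 I2) by move=> ? ? [].
rewrite (_ : P _ = P [set w | forall i, i \in map inl J ++ map inr K ->
   (match i with inl i => A i | inr i => B i end) (X i w)]); last first.
  congr (P _); apply/seteqP; split => w /=.
    move=> [hA hB] i; rewrite mem_cat => /orP[]/mapP[j jJ ->]; first exact: hA.
    exact: hB.
  move=> h; split => i iJ.
    by apply: (h (inl i)); rewrite mem_cat (mem_map inlI) iJ.
  by apply: (h (inr i)); rewrite mem_cat (mem_map inrI) iJ orbT.
rewrite [LHS](iX (map inl J ++ map inr K)
  (fun i => match i with inl i => A i | inr i => B i end)); last 2 first.
- rewrite cat_uniq !map_inj_uniq// uJ uK andbT/=.
  by apply/hasPn => _ /mapP[k _ ->]; apply/mapP => -[].
- by case.
rewrite big_cat/= !big_map; congr (_ * _)%E.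
- exact/esym/(mutually_independent_reindex P X inl inlI iX).
- exact/esym/(mutually_independent_reindex P X inr inrI iX).
Qed.

End paths.

(** * Stacks as random elements *)

Section measurability_extra.
Context {R : realType}.

Lemma measurable_fun_nat {d} {O : measurableType d} (N : O -> nat) :
  (forall n, measurable (N @^-1` [set n])) -> measurable_fun setT N.
Proof.
move=> mN _ A _; rewrite setTI.
rewrite (_ : _ @^-1` A = \bigcup_(n in A) (N @^-1` [set n])); last first.
  apply/seteqP; split => w /=; first by move=> h; exists (N w).
  by move=> [n An /= ->].
exact: bigcup_measurable.
Qed.

Lemma measurable_fun_index {d d'} {O : measurableType d} {V : measurableType d'}
    (F : nat -> O -> V) (N : O -> nat) :
  (forall n, measurable_fun setT (F n)) -> measurable_fun setT N ->
  measurable_fun setT (fun w => F (N w) w).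
Proof.
move=> mF mN _ A mA; rewrite setTI.
rewrite (_ : _ @^-1` A = \bigcup_n (N @^-1` [set n] `&` F n @^-1` A)); last first.
  apply/seteqP; split => w /=; first by move=> h; exists (N w).
  by move=> [n _ /= [-> ]].
by apply: bigcupT_measurable => n; apply: measurableI; exact: preimage_measurable.
Qed.

Lemma measurable_truncn : measurable_fun setT (@Num.truncn R).
Proof.
apply: measurable_fun_nat => -[|n].
  rewrite (_ : _ @^-1` _ = `]-oo, 1%R[%classic)//.
  by apply/seteqP; split => x /=; rewrite in_itv/= ltNge => /truncn0Pn.
rewrite (_ : _ @^-1` _ = `[n.+1%:R, n.+2%:R[%classic)//.
apply/seteqP; split => x /=; rewrite in_itv/=; last exact: truncn_def.
by rewrite ltNge -!truncn_gt_nat -leqNgt => ->; rewrite ltnSn.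
Qed.

Lemma measurable_fun_natr {d} {O : measurableType d} (N : O -> nat) :
  measurable_fun setT (fun w => (N w)%:R : R) -> measurable_fun setT N.
Proof.
move=> mN; rewrite (_ : N = fun w => Num.truncn ((N w)%:R : R)); last first.
  by apply/funext => w; rewrite natrK.
by apply: measurableT_comp mN; exact: measurable_truncn.
Qed.

Lemma measurable_fun_natr_cast {d} {O : measurableType d} (N : O -> nat) :
  measurable_fun setT N -> measurable_fun setT (fun w => (N w)%:R : R).
Proof. by move=> mN; exact: (measurableT_comp (f := fun n => n%:R : R)). Qed.

End measurability_extra.

HB.instance Definition _ (R : realType) := isPointed.Build (seq R) [::].

(** Stacks receive the sigma-algebra pulled back along this code, so that measurability of a random
    stack is checked on its length and its entries. Entries past the end have the default value
    0. *)
Definition stack_code {R : realType} (stk : seq R) : paths (option nat) R :=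
  fun o => if o is Some i then stk`_i else (size stk)%:R.

Notation stack R := (g_sigma_algebra_preimageType (@stack_code R)).

Section stack.
Context {R : realType}.

Lemma measurable_stack_code : measurable_fun setT (@stack_code R : stack R -> _).
Proof. by move=> _ A mA; exists A. Qed.

Lemma measurable_stack_size : measurable_fun setT (size : stack R -> nat).
Proof.
apply: (measurable_fun_natr (R := R)).
exact: (measurableT_comp (measurable_coord (None : option nat)) measurable_stack_code).
Qed.

Lemma measurable_stack_nth i : measurable_fun setT (fun stk : stack R => stk`_i).
Proof.
exact: (measurableT_comp (measurable_coord (Some i : option nat))
  measurable_stack_code).
Qed.

Lemma measurable_fun_stack {d} {O : measurableType d} (L : O -> stack R) :
  measurable_fun setT (fun w => size (L w)) ->
  (forall i, measurable_fun setT (fun w => (L w)`_i)) -> measurable_fun setT L.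
Proof.
move=> ms mn _ _ [B mB <-]; rewrite !setTI.
apply: (preimage_measurable (stack_code \o L)) mB.
apply: measurable_fun_paths => -[i|]; first exact: mn.
exact: measurable_fun_natr_cast.
Qed.

Lemma measurable_stack_mkseq {d} {O : measurableType d} (N : O -> nat)
    (S : nat -> O -> R) :
  measurable_fun setT N -> (forall i, measurable_fun setT (S i)) ->
  measurable_fun setT (fun w => mkseq (S ^~ w) (N w) : stack R).
Proof.
move=> mN mS; apply: measurable_fun_stack => [|i].
  by under eq_fun do rewrite size_mkseq.
rewrite (_ : (fun w => _) = fun w => if (i < N w)%N then S i w else 0).
  apply: measurable_fun_ifT => //.
  exact: measurable_fun_ltn.
apply/funext => w; case: ifPn => iN; first by rewrite nth_mkseq.
by rewrite nth_default// size_mkseq leqNgt.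
Qed.

Lemma measurable_stack_behead : measurable_fun setT (behead : stack R -> stack R).
Proof.
apply: measurable_fun_stack => [|i].
  rewrite (_ : (fun w => _) = (fun w : stack R => size w - 1)%N).
    by apply: measurable_fun_subn => //; exact: measurable_stack_size.
  by apply/funext => w; rewrite size_behead subn1.
under eq_fun do rewrite nth_behead.
exact: measurable_stack_nth.
Qed.

Lemma measurable_stack_cat {d} {O : measurableType d} (L1 L2 : O -> stack R) :
  measurable_fun setT L1 -> measurable_fun setT L2 ->
  measurable_fun setT (fun w => L1 w ++ L2 w : stack R).
Proof.
move=> m1 m2.
have ms1 : measurable_fun setT (fun w => size (L1 w)).
  exact: (measurableT_comp measurable_stack_size m1).
have ms2 : measurable_fun setT (fun w => size (L2 w)).
  exact: (measurableT_comp measurable_stack_size m2).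
apply: measurable_fun_stack => [|i].
  by under eq_fun do rewrite size_cat; exact: measurable_fun_addn.
under eq_fun do rewrite nth_cat.
apply: measurable_fun_ifT.
- exact: measurable_fun_ltn.
- exact: (measurableT_comp (measurable_stack_nth i) m1).
- apply: (measurable_fun_index (fun n w => (L2 w)`_n)) => [n|].
    exact: (measurableT_comp (measurable_stack_nth n) m2).
  exact: measurable_fun_subn.
Qed.

Lemma measurable_stack_cons {d} {O : measurableType d} (t : O -> R) (L : O -> stack R) :
  measurable_fun setT t -> measurable_fun setT L ->
  measurable_fun setT (fun w => t w :: L w : stack R).
Proof.
move=> mt mL.
apply: (measurable_stack_cat (fun w => [:: t w]) L) => //.
exact: (measurable_stack_mkseq (cst 1%N) (fun=> t)).
Qed.

End stack.

(** * Autonomous dynamics of the queue *)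

Section dynamics.
Context {R : realType}.
Implicit Types (x : paths input_idx R) (stk : stack R).

(** A path stores the batch size as a real number; truncation recovers the natural number. *)
Definition batch_of x : stack R :=
  mkseq (fun i => x (IS 0 i)) (Num.truncn (x (IB 0))).

Definition shift_idx (i : input_idx) : input_idx :=
  match i with IT n => IT n.+1 | IB n => IB n.+1 | IS n i => IS n.+1 i end.

Definition shift x : paths input_idx R := fun i => x (shift_idx i).

(* In a state [(stk, r, x)] the next batch is always batch 0 of the future inputs
   [x], which are shifted at every arrival: this makes the dynamics autonomous. *)
Definition qstep (q : stack R * R * paths input_idx R) :
    stack R * R * paths input_idx R :=
  let: (stk, r, x) := q in
  match stk with
  | [::] => q
  | tau :: rest =>
      if tau <= r then (rest, r - tau, x) else (batch_of x ++ stk, x (IT 0), shift x)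
  end.

Definition safe (a : R) : set (stack R * R * paths input_idx R) :=
  [set q | forall j, (size (iter j qstep q).1.1)%:R <= a].

Lemma safe_nil a r x : safe a ([::], r, x) <-> 0 <= a.
Proof.
split=> [/(_ 0%N)//|a0 j].
by rewrite (_ : iter j _ _ = ([::], r, x))//; elim: j => //= j ->.
Qed.

Lemma safe_step a q : safe a q <-> (size q.1.1)%:R <= a /\ safe a (qstep q).
Proof.
split=> [h|[h0 h] [//|j]]; last by rewrite iterSr; exact: h.
by split=> [|j]; [exact: (h 0%N)|rewrite -iterSr; exact: (h j.+1)].
Qed.

Lemma safe_cons a tau rest r x : safe a (tau :: rest, r, x) <->
  (size rest).+1%:R <= a /\
  if tau <= r then safe a (rest, r - tau, x)
  else safe a (batch_of x ++ tau :: rest, x (IT 0), shift x).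
Proof. by rewrite safe_step /=; case: ifP. Qed.

Lemma measurable_batch_of : measurable_fun setT batch_of.
Proof.
apply: (measurable_stack_mkseq (fun x => Num.truncn (x (IB 0)))
  (fun i x => x (IS 0 i))) => [|i].
  exact: (measurableT_comp measurable_truncn (measurable_coord (IB 0))).
exact: measurable_coord.
Qed.

Lemma measurable_shift : measurable_fun setT shift.
Proof. by apply: measurable_fun_paths => i; exact: measurable_coord. Qed.

Lemma measurable_qstep : measurable_fun setT qstep.
Proof.
pose q := (stack R * R * paths input_idx R)%type.
have mstk : measurable_fun setT (fun p : q => p.1.1).
  exact: (measurableT_comp measurable_fst measurable_fst).
have mr : measurable_fun setT (fun p : q => p.1.2).
  exact: (measurableT_comp measurable_snd measurable_fst).
have mx : measurable_fun setT (fun p : q => p.2) by exact: measurable_snd.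
have mhd : measurable_fun setT (fun p : q => (p.1.1)`_0).
  exact: (measurableT_comp (measurable_stack_nth 0) mstk).
rewrite (_ : qstep = fun p : q => if size p.1.1 == 0%N then p else
    if (p.1.1)`_0 <= p.1.2 then (behead p.1.1, p.1.2 - (p.1.1)`_0, p.2)
    else (batch_of p.2 ++ p.1.1, p.2 (IT 0), shift p.2)); last first.
  by apply/funext => -[[[|tau rest] r] x].
apply: measurable_fun_ifT => //.
  apply: measurable_fun_eqn => //.
  exact: (measurableT_comp measurable_stack_size mstk).
apply: measurable_fun_ifT.
- exact: measurable_fun_ler.
- apply: measurable_fun_pair => //; apply: measurable_fun_pair.
    exact: (measurableT_comp measurable_stack_behead mstk).
  exact: measurable_funB.
- apply: measurable_fun_pair; last exact: (measurableT_comp measurable_shift mx).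
  apply: measurable_fun_pair.
    apply: measurable_stack_cat => //.
    exact: (measurableT_comp measurable_batch_of mx).
  exact: (measurableT_comp (measurable_coord (IT 0)) mx).
Qed.

Lemma measurable_safe a : measurable (safe a).
Proof.
rewrite (_ : safe a = \bigcap_j [set q | (size (iter j qstep q).1.1)%:R <= a]); last first.
  by apply/seteqP; split => q h j => [_|]; exact: h.
apply: bigcapT_measurable => j.
have mit : measurable_fun setT (iter j qstep).
  elim: j => [|j IH]; first exact: measurable_id.
  exact: (measurableT_comp measurable_qstep IH).
have mN : measurable_fun setT (fun q => size (iter j qstep q).1.1).
  apply: (measurableT_comp measurable_stack_size).
  by apply: (measurableT_comp measurable_fst); exact: (measurableT_comp measurable_fst).
rewrite (_ : mkset _ = (fun q => (size (iter j qstep q).1.1)%:R) @^-1` `]-oo, a]%classic).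
  by apply: preimage_measurable => //; exact: measurable_fun_natr_cast.
by apply/seteqP; split => q /=; rewrite in_itv.
Qed.

(** Both dynamics run in lockstep. Batch 0 and [A 1] are already part of the initial state, so the
    remaining inputs begin with batch 1 and [A 2]; hence the offsets in the hypotheses. *)
Lemma busy_max_le (A : nat -> R) (B : nat -> nat) (sig : nat -> nat -> R) x a :
  (forall n, x (IT n) = A n.+2) -> (forall n, x (IB n) = (B n.+1)%:R) ->
  (forall n i, x (IS n i) = sig n.+1 i) ->
  (busy_max A B sig <= a%:E)%E <-> safe a (push_batch B sig 0, A 1%N, x).
Proof.
move=> xT xB xS.
(* Invariant: stack and residual time agree, and [q.2] is the input sequence read from the next
   batch [s.2] onwards. *)
have H j : let s := iter j (step A B sig) (init_state A B sig) in
           let q := iter j qstep (push_batch B sig 0 : stack R, A 1%N, x) in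
    [/\ q.1 = s.1, (forall n, q.2 (IT n) = A (s.2 + n.+1)%N),
        (forall n, q.2 (IB n) = (B (s.2 + n)%N)%:R) &
        forall n i, q.2 (IS n i) = sig (s.2 + n)%N i].
  elim: j => [|j] /=; first by split.
  move: (iter j _ _) (iter j _ _) => [[stk r] n] [[stk' r'] x'] /= [[-> ->] hT hB hS].
  case: stk => [|tau rest]; first by split.
  case: ifP => _; first by split.
  split => /= [|m|m|m i]; [|by rewrite /shift/= hT addnS|by rewrite /shift/= hB addnS|
    by rewrite /shift/= hS addnS].
  congr ((_ ++ _), _); last by rewrite hT addn1.
  rewrite /batch_of /push_batch hB natrK addn0 /mkseq.
  by apply: eq_map => i; rewrite hS addn0.
split=> [/ereal_supP h j|h].
  have [/= -> _ _ _] := H j.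
  by rewrite -lee_fin; apply: h; exists j.
apply/ereal_supP => _ [j _ <-]; rewrite lee_fin.
by rewrite /nsys; have [<- _ _ _] := H j; exact: h.
Qed.

End dynamics.

(** * The equation for the probability of staying below a level *)

Section queue.
Context {d : measure_display} {Omega : measurableType d} {R : realType}.
Variables (P : probability Omega R) (X : input_idx -> Omega -> R).
Hypothesis mX : forall i, measurable_fun setT (X i).
Hypothesis iX : mutually_independent P X.
Local Open Scope ereal_scope.

Let path w : paths input_idx R := X ^~ w.

Lemma measurable_path : measurable_fun setT path.
Proof. exact: measurable_fun_paths. Qed.

Definition same_marginals {I : eqType} (s t : I -> input_idx) :=
  forall i A, measurable A -> P (X (s i) @^-1` A) = P (X (t i) @^-1` A).

(** Renaming independent inputs injectively, with marginals kept, does not change their joint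
    law. *)
Lemma eqdist_reindex {I : eqType} (s t : I -> input_idx) :
  injective s -> injective t -> same_marginals s t ->
  eqdist P (fun w => X ^~ w \o s : paths I R) P (fun w => X ^~ w \o t : paths I R).
Proof.
move=> si ti st; apply: (eqdist_paths P P (X \o s) (X \o t)) => //.
- by move=> i; exact: mX.
- by move=> i; exact: mX.
- exact: mutually_independent_reindex.
- exact: mutually_independent_reindex.
Qed.

(* the probability that a busy period never exceeds [a] customers when it is
   started from the stack [stk] with a fresh interarrival time *)
Definition safe_prob (a : R) (stk : stack R) : \bar R :=
  P [set w | safe a (stk, X (IT 0) w, shift (path w))].

Let stream w : R * paths input_idx R := (X (IT 0) w, shift (path w)).

Let measurable_stream : measurable_fun setT stream.
Proof.
apply: measurable_fun_pair => //.
exact: (measurableT_comp measurable_shift measurable_path).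
Qed.

(** The event [safe a], bracketed so that the stack and the future inputs form the two components to
    which independence is applied. *)
Let safe' a : set (stack R * (R * paths input_idx R)) :=
  [set q | safe a (q.1, q.2.1, q.2.2)].

Let measurable_safe' a : measurable (safe' a).
Proof.
apply: (preimage_measurable (fun q : stack R * (R * paths input_idx R) =>
  (q.1, q.2.1, q.2.2)) (safe a)); last exact: measurable_safe.
apply: measurable_fun_pair; last exact: (measurableT_comp measurable_snd measurable_snd).
apply: measurable_fun_pair; first exact: measurable_fst.
exact: (measurableT_comp measurable_fst measurable_snd).
Qed.

Lemma measurable_safe_prob a : measurable_fun setT (safe_prob a).
Proof.
exact: measurable_section_prob measurable_stream (measurable_safe' a).
Qed.

Lemma measurable_safe_event a (S : Omega -> stack R) : measurable_fun setT S ->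
  measurable [set w | safe a (S w, X (IT 0) w, shift (path w))].
Proof.
move=> mS; apply: (preimage_measurable (fun w => (S w, stream w))
  (safe' a)) => //; exact: measurable_fun_pair.
Qed.

Lemma safe_prob01 a stk : 0 <= safe_prob a stk <= 1.
Proof.
rewrite measure_ge0/= probability_le1//.
exact: (measurable_safe_event a (cst stk)).
Qed.

Let head_idx (o : option nat) : input_idx := if o is Some i then IS 0 i else IB 0.
Let tail_idx (o : option input_idx) : input_idx :=
  if o is Some i then shift_idx i else IT 0.

Lemma shift_idx_inj : injective shift_idx.
Proof. by move=> [n|n|n i] [m|m|m j] //= [] ->// ->. Qed.

(* A stack built from batch 0 is independent of the arrival process and of the later
   batches. *)
Lemma safe_prob_stack (a : R) (f : paths (option nat) R -> stack R) :
  measurable_fun setT f ->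
  let S w := f (fun o => X (if o is Some i then IS 0 i else IB 0) w) in
  P [set w | safe a (S w, X (IT 0) w, shift (path w))] =
  \int[P]_w safe_prob a (S w).
Proof.
move=> mf S.
(* Two disjoint groups of inputs: batch 0 on the left, the first interarrival time and everything
   later on the right. *)
pose s (o : option nat + option input_idx) : input_idx :=
  match o with inl o => head_idx o | inr o => tail_idx o end.
have s_inj : injective s.
  case=> [[i|]|[i|]] [[j|]|[j|]] //=; rewrite /head_idx/=.
  - by case=> ->.
  - by case: j.
  - by case: j.
  - by case: i.
  - by case: i.
  - by move/shift_idx_inj => ->.
  - by case: i.
  - by case: j.
have iXs := mutually_independent_reindex P X s s_inj iX.
have ind := independent2_groups P (fun o => X (s o)) (fun o => mX (s o)) iXs.
pose g (y : paths (option input_idx) R) : R * paths input_idx R :=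
  (y None, fun i => y (Some i)).
have mg : measurable_fun setT g.
  apply: measurable_fun_pair; first exact: measurable_coord.
  by apply: measurable_fun_paths => i; exact: measurable_coord.
have {}ind : independent2 P S stream.
  exact: (independent2_comp P _ _ f g mf mg ind).
apply: (independent2_integral P S stream (safe' a)) => //.
by apply: (measurableT_comp mf); exact: measurable_fun_paths.
Qed.

Hypothesis stationary : same_marginals shift_idx id.
Hypothesis memoryless : forall (tau : R) (C : set R), (0 <= tau)%R -> measurable C ->
  P [set w | (tau <= X (IT 0) w)%R /\ C (X (IT 0) w - tau)%R] =
  P [set w | (tau <= X (IT 0) w)%R] * P [set w | C (X (IT 0) w)].

Let indep_first_arrival : independent2 P (X (IT 0)) (fun w => shift (path w)).
Proof.
pose s (o : unit + input_idx) : input_idx :=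
  match o with inl _ => IT 0 | inr o => shift_idx o end.
have s_inj : injective s.
  by case=> [[]|i] [[]|j] //=; [case: j|case: i|move/shift_idx_inj => ->].
have iXs := mutually_independent_reindex P X s s_inj iX.
have ind := independent2_groups P (fun o => X (s o)) (fun o => mX (s o)) iXs.
apply: (independent2_comp P _ _ (fun y : paths unit R => y tt) id _ _ ind) => //.
exact: measurable_coord.
Qed.

Lemma safe_prob_nil a : safe_prob a [::] = (0 <= a)%R%:R%:E.
Proof.
rewrite /safe_prob; case: (boolP (0 <= a)%R) => a0.
  rewrite (_ : mkset _ = setT) ?probability_setT//.
  by apply/seteqP; split => // w _; apply/safe_nil.
rewrite (_ : mkset _ = set0) ?measure0//.
by apply/seteqP; split => // w /safe_nil; rewrite (negbTE a0).
Qed.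

(** First-step analysis: either the head completes before the first arrival, or that arrival puts a
    new batch on top of the unchanged stack. *)
Lemma safe_prob_cons a (tau : R) (rest : stack R) : (0 <= tau)%R ->
  safe_prob a (tau :: rest) =
  if ((size rest).+1%:R <= a)%R then
    P [set w | (tau <= X (IT 0) w)%R] * safe_prob a rest +
    P [set w | (X (IT 0) w < tau)%R] *
      \int[P]_w safe_prob a (batch_of (path w) ++ tau :: rest : stack R)
  else 0.
Proof.
move=> tau0; case: ifPn => sa; last first.
  rewrite /safe_prob (_ : mkset _ = set0) ?measure0//.
  by apply/seteqP; split => // w /safe_cons[]; rewrite (negbTE sa).
pose E1 := [set q : paths input_idx R * R |
  (tau <= q.2)%R /\ safe a (rest, q.2 - tau, q.1)%R].
pose F := [set x : paths input_idx R |
  safe a (batch_of x ++ tau :: rest, x (IT 0), shift x)].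
have mE1 : measurable E1.
  rewrite (_ : E1 = snd @^-1` `[tau, +oo[%classic `&`
    (fun q : paths input_idx R * R => (rest, q.2 - tau, q.1)%R) @^-1` safe a); last first.
    by apply/seteqP; split => q /=; rewrite in_itv/= andbT.
  apply: measurableI; first exact: preimage_measurable.
  apply: preimage_measurable; last exact: measurable_safe.
  apply: measurable_fun_pair => //; apply: measurable_fun_pair => //.
  exact: measurable_funB.
have mF : measurable F.
  apply: (preimage_measurable (fun x : paths input_idx R =>
    (batch_of x ++ tau :: rest : stack R, x (IT 0), shift x)));
    last exact: measurable_safe.
  apply: measurable_fun_pair; last exact: measurable_shift.
  apply: measurable_fun_pair; last exact: measurable_coord.
  by apply: measurable_stack_cat => //; exact: measurable_batch_of.
have mshift : measurable_fun setT (fun w => shift (path w)).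
  exact: (measurableT_comp measurable_shift measurable_path).
have mlt : measurable [set w | (X (IT 0) w < tau)%R].
  rewrite (_ : mkset _ = X (IT 0) @^-1` `]-oo, tau[%classic).
    exact: preimage_measurable.
  by apply/seteqP; split => q /=; rewrite in_itv.
rewrite /safe_prob.
have -> : [set w | safe a (tau :: rest, X (IT 0) w, shift (path w))] =
    [set w | E1 (shift (path w), X (IT 0) w)] `|`
    ([set w | (X (IT 0) w < tau)%R] `&` (fun w => shift (path w)) @^-1` F).
  apply/seteqP; split => w /=.
    move/safe_cons => [_]; case: ifPn => h; first by left.
    by right; split => //; rewrite ltNge.
  move=> [[h1 h2]|[h1 h2]]; apply/safe_cons; split => //; first by rewrite h1.
  by rewrite leNgt h1.
rewrite measureU; first last.
- apply/seteqP; split => w //= -[[/= h _] [+ _]].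
  by rewrite ltNge h.
- by apply: measurableI => //; exact: preimage_measurable.
- apply: (preimage_measurable (fun w => (shift (path w), X (IT 0) w))) => //.
  exact: measurable_fun_pair.
congr (_ + _).
  (* Completion: with the later inputs frozen, [memoryless] replaces the residual time after the
     service by a fresh interarrival time. *)
  have indC := independent2C _ _ _ indep_first_arrival.
  rewrite [LHS](independent2_integral P _ _ E1 mshift (mX _) indC)//.
  pose E2 := [set q : paths input_idx R * R | safe a (rest, q.2, q.1)].
  have mE2 : measurable E2.
    apply: (preimage_measurable (fun q : paths input_idx R * R =>
      (rest : stack R, q.2, q.1)));
      last exact: measurable_safe.
    by apply: measurable_fun_pair => //; exact: measurable_fun_pair.
  rewrite [X in _ = _ * X](independent2_integral P _ _ E2 mshift (mX _) indC)//.
  rewrite -ge0_integralZl; [ |by []| |by move=> w _; exact: measure_ge0|exact: measure_ge0];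
    last exact: (measurableT_comp (measurable_section_prob P _ _ (mX (IT 0)) mE2) mshift).
  apply: eq_integral => w _ /=.
  apply: (memoryless tau [set t | safe a (rest, t, shift (path w))]) => //.
  apply: (preimage_measurable (fun t => (rest : stack R, t, shift (path w))));
    last exact: measurable_safe.
  by apply: measurable_fun_pair => //; exact: measurable_fun_pair.
have -> : [set w | (X (IT 0) w < tau)%R] = X (IT 0) @^-1` `]-oo, tau[%classic.
  by apply/seteqP; split => q /=; rewrite in_itv.
rewrite [LHS](indep_first_arrival `]-oo, tau[%classic F)//; congr (_ * _).
(* Interruption: by stationarity the shifted inputs may be replaced by the original ones, whose
   batch 0 then plays the interrupting batch. *)
rewrite (_ : P _ = P (path @^-1` F)); last first.
  exact: (eqdist_reindex shift_idx id shift_idx_inj _ stationary).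
pose f (y : paths (option nat) R) : stack R :=
  mkseq (fun i => y (Some i)) (Num.truncn (y None)) ++ tau :: rest.
apply: (safe_prob_stack a f).
apply: measurable_stack_cat => //.
apply: (measurable_stack_mkseq (fun x : paths (option nat) R => Num.truncn (x None))
  (fun i x => x (Some i))) => [|i].
  exact: (measurableT_comp measurable_truncn (measurable_coord (None : option nat))).
exact: (measurable_coord (Some i : option nat)).
Qed.

End queue.

(** * Memorylessness of the exponential law, from its distribution function *)

Section exponential_law.
Context {d : measure_display} {Omega : measurableType d} {R : realType}.
Variables (P : probability Omega R) (lam : R) (T : Omega -> R).
Hypothesis lam0 : 0 < lam.
Hypothesis mT : measurable_fun setT T.
Hypothesis hT : forall t : R,
  P [set w | T w <= t] = (if 0 <= t then 1 - expR (- (lam * t)) else 0)%:E.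

Let measurable_lt t : measurable [set w | T w < t].
Proof.
rewrite (_ : mkset _ = T @^-1` `]-oo, t[%classic); first exact: preimage_measurable.
by apply/seteqP; split => q /=; rewrite in_itv.
Qed.

Let measurable_le t : measurable [set w | T w <= t].
Proof.
rewrite (_ : mkset _ = T @^-1` `]-oo, t]%classic); first exact: preimage_measurable.
by apply/seteqP; split => q /=; rewrite in_itv.
Qed.

(** The law has no atoms: by continuity of the distribution function, a jump at [t] would be
    contradicted by a point slightly to the left of [t]. *)
Lemma exponential_lt t :
  P [set w | T w < t] = (if 0 <= t then 1 - expR (- (lam * t)) else 0)%:E.
Proof.
have Plt_fin : P [set w | T w < t] \is a fin_num by exact: fin_num_measure.
have ub : (P [set w | (T w < t)%R] <= P [set w | (T w <= t)%R])%E.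
  by rewrite le_measure// ?inE// => w /=; exact: ltW.
have [t0|t0] := leP 0 t; last first.
  apply/eqP; rewrite eq_le measure_ge0 andbT.
  by rewrite (le_trans ub)// hT (lt_geF t0).
apply/eqP; rewrite eq_le; apply/andP; split; first by rewrite (le_trans ub)// hT t0.
rewrite -(fineK Plt_fin) lee_fin; set p := fine _.
rewrite leNgt; apply/negP => plt.
have e0 : 0 < expR (- (lam * t)) := expR_gt0 _.
(* [c] is the midpoint of the supposed gap, and [e] is chosen so that
   [expR (- (lam * (t - e))) = c]. *)
pose c := (1 - p + expR (- (lam * t))) / 2.
have cgt : expR (- (lam * t)) < c by rewrite /c; lra.
have clt : c < 1 - p by rewrite /c; lra.
have c0 : 0 < c by exact: lt_trans cgt.
pose e := ln c / lam + t.
have e_gt0 : 0 < e.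
  have : - (lam * t) < ln c by rewrite -[ltLHS]expRK ltr_ln ?posrE.
  by rewrite /e -ltrBlDr sub0r ltr_pdivlMr// mulNr mulrC.
have : (P [set w | (T w <= t - e)%R] <= P [set w | (T w < t)%R])%E.
  rewrite le_measure// ?inE// => w /= h.
  by rewrite (le_lt_trans h)// ltrBlDr ltrDl.
have ce : expR (- (lam * (t - e))) = c.
  rewrite /e opprD addrCA subrr addr0 mulrN opprK mulrC divfK ?gt_eqF//.
  by rewrite lnK ?posrE.
rewrite hT ce -(fineK Plt_fin) lee_fin -/p.
(* If [t - e] were negative, [c] would exceed 1, against [c < 1 - p]. *)
case: ifPn => [_|te]; first by lra.
have : 1 < c by rewrite -ce -expR0 ltr_expR oppr_gt0 pmulr_rlt0// ltNge.
have : 0 <= p by rewrite fine_ge0.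
lra.
Qed.

Lemma exponential_ge t : 0 <= t -> P [set w | t <= T w] = (expR (- (lam * t)))%:E.
Proof.
move=> t0.
rewrite (_ : mkset _ = ~` [set w | T w < t]); last first.
  by apply/seteqP; split => w /=; rewrite leNgt => /negP.
rewrite probability_setC// exponential_lt t0 -EFinB.
by congr EFin; lra.
Qed.

(** Both sides are finite measures in [C], so the usual computation with exponentials is needed only
    on the half-lines []-oo, t[]. *)
Lemma exponential_memoryless (tau : R) (C : set R) : 0 <= tau -> measurable C ->
  P [set w | tau <= T w /\ C (T w - tau)] =
  (P [set w | (tau <= T w)%R] * P [set w | C (T w)])%E.
Proof.
move=> tau0 mC.
have mH : measurable [set w | tau <= T w].
  rewrite (_ : mkset _ = T @^-1` `[tau, +oo[%classic); first exact: preimage_measurable.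
  by apply/seteqP; split => q /=; rewrite in_itv/= andbT.
have mTt : measurable_fun setT (fun w => T w - tau) by exact: measurable_funB.
have [m1 m1E'] := law_measure (mrestr P mH) _ mTt.
have m1E B : m1 B = P [set w | tau <= T w /\ B (T w - tau)].
  by rewrite m1E' /= /mrestr; congr (P _); apply/seteqP; split => w [].
have [m2' m2E'] := law_measure P T mT.
have q0 : 0 <= expR (- (lam * tau)) by exact: expR_ge0.
pose m2 : {measure set _ -> \bar R} := mscale (NngNum q0) m2'.
have m2E B : m2 B = (P [set w | (tau <= T w)%R] * P (T @^-1` B))%E.
  by rewrite /m2/= /mscale/= exponential_ge// m2E'.
rewrite -m1E -[RHS]m2E.
have m1T : m1 setT = P [set w | tau <= T w].
  by rewrite m1E; congr (P _); apply/seteqP; split => w //= -[].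
apply: (finite_measure_ext (@RGenInftyO.G R) m1 m2 (RGenInftyO.measurableE R)) => //.
- move=> _ _ [x ->] [y ->]; exists (Order.min x y).
  by apply/seteqP; split => z /=; rewrite !in_itv/= lt_min => /andP.
- by rewrite m1T -ge0_fin_numE ?fin_num_measure.
- rewrite m1T m2E preimage_setT probability_setT mule1//.
- move=> _ [t ->]; rewrite m1E m2E.
  have -> : T @^-1` `]-oo, t[%classic = [set w | T w < t].
    by apply/seteqP; split => w /=; rewrite in_itv.
  rewrite exponential_ge// exponential_lt.
  have [t0|t0] := leP 0 t; last first.
    rewrite mule0 (_ : mkset _ = set0) ?measure0//.
    by apply/seteqP; split => w //= [h]; rewrite in_itv/=; lra.
  have mD : measurable [set w | tau <= T w /\ `]-oo, t[%classic (T w - tau)].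
    rewrite (_ : mkset _ = [set w | tau <= T w] `&` [set w | T w < tau + t]).
      exact: measurableI.
    by apply/seteqP; split => w /=; rewrite in_itv/= => -[? ?]; split => //; lra.
  (* The probability sought is the difference of the distribution function at [tau + t] and at
     [tau]. *)
  have : P [set w | T w < tau + t] = (P [set w | (T w < tau)%R] +
     P [set w | (tau <= T w)%R /\ (`]-oo, t[%classic (T w - tau)%R)])%E.
    rewrite -measureU//.
    - congr (P _); apply/seteqP; split => w /=; rewrite in_itv/=.
        by move=> h; have [?|?] := ltP (T w) tau; [left|right; split => //; lra].
      by move=> []; lra.
    - by apply/seteqP; split => w //= -[h []]; rewrite leNgt h.
  rewrite !exponential_lt tau0 addr_ge0//.
  have /fineK <- : P [set w | (tau <= T w)%R /\
      (`]-oo, t[%classic (T w - tau)%R)] \is a fin_num.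
    exact: fin_num_measure.
  rewrite -EFinD => -[]; rewrite mulrDr opprD expRD => h.
  by rewrite -EFinM; congr EFin; lra.
Qed.

End exponential_law.

(** * Uniqueness and factorization of the solutions *)

Section comparison.
Context {d : measure_display} {Omega : measurableType d} {R : realType}.
Variables (P : probability Omega R) (lam K : R) (bt : Omega -> stack R).
Hypothesis lam0 : 0 < lam.
Hypothesis K0 : 0 <= K.
Hypothesis mbt : measurable_fun setT bt.
Hypothesis bt0 : forall w, all (>= 0) (bt w).

(** A customer needs [expR (lam * tau)] attempts on average, and each of the [expR (lam * tau) - 1]
    expected failures brings a batch of mean cost [K]; the sum of the two contributions is this
    formula. *)
Definition weight (tau : R) : R := expR (lam * tau) * (1 + K) - K.

(* the expected number of events before the stack [stk] is emptied *)
Definition total_weight (stk : seq R) : R := \sum_(tau <- stk) weight tau.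

Hypothesis bt_weight : (\int[P]_w (total_weight (bt w))%:E = K%:E)%E.

(** Stated for an arbitrary [h], so that [u a] and products built from it can be compared. It leaves
    the value at the empty stack free, which acts as the boundary condition. *)
Definition safe_equation (a : R) (h : stack R -> \bar R) := forall tau rest, 0 <= tau ->
  h (tau :: rest) = (if ((size rest).+1%:R <= a)%R then
    (expR (- (lam * tau)))%:E * h rest +
    (1 - expR (- (lam * tau)))%:E * \int[P]_w h (bt w ++ tau :: rest : stack R)
  else 0)%E.

Lemma weight_ge1 tau : 0 <= tau -> 1 <= weight tau.
Proof.
move=> t0; rewrite /weight.
have : 1 <= expR (lam * tau) by rewrite -expR0 ler_expR mulr_ge0// ltW.
rewrite -subr_ge0 => /mulr_ge0 /(_ (addr_ge0 ler01 K0)) h; lra.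
Qed.

(** Balance of one event: the mean weight [(1 - p) * K] gained from interruptions, plus 1, equals
    the mean weight [p * weight tau] lost by completion, where [p = expR (- (lam * tau))]. *)
Lemma weight_drift tau : 1 + (1 - expR (- (lam * tau))) * K =
  expR (- (lam * tau)) * weight tau.
Proof.
have : expR (- (lam * tau)) * expR (lam * tau) = 1 by rewrite -expRD addNr expR0.
by rewrite /weight mulrBr mulrA => ->; ring.
Qed.

Lemma total_weight_ge0 stk : all (>= 0) stk -> 0 <= total_weight stk.
Proof.
move=> /allP h; rewrite /total_weight big_seq sumr_ge0// => t /h t0.
exact: le_trans (weight_ge1 _ t0).
Qed.

Lemma measurable_total_weight :
  measurable_fun setT (fun w => total_weight (bt w)).
Proof.
have mw i : measurable_fun setT (fun w => weight (bt w)`_i).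
  apply: measurable_funB => //; apply: measurable_funM => //.
  apply: (measurableT_comp (@measurable_expR R)); apply: measurable_funM => //.
  exact: (measurableT_comp (measurable_stack_nth i) mbt).
rewrite (_ : (fun w => _) =
    fun w => (fun n w => \sum_(i < n) weight (bt w)`_i) (size (bt w)) w); last first.
  by apply/funext => w; rewrite /total_weight (big_nth 0) big_mkord.
apply: (measurable_fun_index (fun n w => \sum_(i < n) weight (bt w)`_i)) => [n|].
  by apply: measurable_sum => i; exact: mw.
exact: (measurableT_comp measurable_stack_size mbt).
Qed.

Let measurable_bt_cat (h : stack R -> \bar R) stk : measurable_fun setT h ->
  measurable_fun setT (fun w => h (bt w ++ stk : stack R)).
Proof. by move=> mh; apply: (measurableT_comp mh); exact: measurable_stack_cat. Qed.

(* Iterating the equation [j] times costs at most the expected number of events, so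
   that [j * (f - g)] stays bounded as [j] grows. *)
Lemma safe_equation_le a (f g : stack R -> \bar R) :
  measurable_fun setT f -> measurable_fun setT g ->
  (forall stk, 0 <= f stk <= 1)%E -> (forall stk, 0 <= g stk <= 1)%E ->
  safe_equation a f -> safe_equation a g -> (f [::] <= g [::])%E ->
  forall stk, all (>= 0) stk -> (f stk <= g stk)%E.
Proof.
move=> mf mg f01 g01 ef eg fg0.
have fin01 (y : \bar R) : (0 <= y <= 1)%E -> y \is a fin_num.
  by move=> /andP[y0 y1]; rewrite ge0_fin_numE// (le_lt_trans y1)// ltry.
have ffin stk := fin01 _ (f01 stk); have gfin stk := fin01 _ (g01 stk).
have int01 (h : stack R -> \bar R) stk : measurable_fun setT h ->
    (forall stk, 0 <= h stk <= 1)%E -> (0 <= \int[P]_w h (bt w ++ stk : stack R) <= 1)%E.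
  move=> mh h01; apply/andP; split.
    by apply: integral_ge0 => w _; have /andP[] := h01 (bt w ++ stk).
  rewrite (@le_trans _ _ (\int[P]_w cst 1 w)%E)//; last first.
    by rewrite integral_cst// mul1e; exact: probability_le1.
  apply: ge0_le_integral => //.
  - by move=> w _; have /andP[] := h01 (bt w ++ stk).
  - exact: measurable_bt_cat.
  - by move=> w _; have /andP[] := h01 (bt w ++ stk).
(* Induction on [j] for all stacks at once, since one event leads either to the shorter stack or to
   a longer one. *)
have main j stk : all (>= 0) stk ->
    j%:R * fine (f stk) <= j%:R * fine (g stk) + total_weight stk.
  elim: j stk => [|j IH] stk stk0; first by rewrite !mul0r add0r total_weight_ge0.
  have := total_weight_ge0 _ stk0.
  case: stk stk0 => [_|tau rest /[dup] stk0 /= /andP[tau0 rest0]] W0.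
    rewrite {1}/total_weight big_nil addr0 ler_pM2l// fine_le//.
  have [sa|sa] := boolP ((size rest).+1%:R <= a); last first.
    rewrite ef// (negbTE sa) mulr0 addr_ge0// mulr_ge0// fine_ge0//.
    by have /andP[] := g01 (tau :: rest).
  (* Passing from [j] to [j + 1] adds at most 1 on the left and at least 0 on the right; the unit
     drop of the mean weight pays for it. *)
  have f1 : fine (f (tau :: rest)) <= 1.
    by rewrite -lee_fin fineK//; have /andP[] := f01 (tau :: rest).
  have g0 : 0 <= fine (g (tau :: rest)).
    by rewrite fine_ge0//; have /andP[] := g01 (tau :: rest).
  have Ffin := fin01 _ (int01 f (tau :: rest) mf f01).
  have Gfin := fin01 _ (int01 g (tau :: rest) mg g01).
  have := ef tau rest tau0; have := eg tau rest tau0; rewrite sa.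
  (* The induction hypothesis on the enlarged stack, averaged over the interrupting batch, whose
     mean weight is [K]. *)
  have : (j%:R%:E * \int[P]_w f (bt w ++ tau :: rest : stack R) <=
      j%:R%:E * \int[P]_w g (bt w ++ tau :: rest : stack R) +
      (K + total_weight (tau :: rest))%:E)%E.
    rewrite EFinD -bt_weight -ge0_integralZl//; last 2 first.
    - exact: measurable_bt_cat.
    - by move=> w _; have /andP[] := f01 (bt w ++ tau :: rest).
    rewrite -ge0_integralZl//; last 2 first.
    - exact: measurable_bt_cat.
    - by move=> w _; have /andP[] := g01 (bt w ++ tau :: rest).
    have -> : (total_weight (tau :: rest))%:E =
        (\int[P]_w cst (total_weight (tau :: rest))%:E w)%E.
      by rewrite integral_cst// [X in (_ * X)%E](probability_setT P) mule1.
    have mV : measurable_fun setT (fun w => (total_weight (bt w))%:E).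
      exact/measurable_EFinP/measurable_total_weight.
    have V0 w : (0 <= (total_weight (bt w))%:E)%E.
      by rewrite lee_fin total_weight_ge0.
    have mjg : measurable_fun setT (fun w =>
        (j%:R%:E * g (bt w ++ tau :: rest : stack R))%E).
      by apply: emeasurable_funM => //; exact: measurable_bt_cat.
    have jg0 w : (0 <= j%:R%:E * g (bt w ++ tau :: rest : stack R))%E.
      by rewrite mule_ge0//; have /andP[] := g01 (bt w ++ tau :: rest).
    have W0' (w : Omega) : (0 <= cst (total_weight (tau :: rest))%:E w)%E.
      by rewrite lee_fin.
    rewrite -ge0_integralD//.
    rewrite -ge0_integralD; [|by []|by move=> w _|exact: mjg|by move=> w _; rewrite adde_ge0
      |exact: emeasurable_funD].
    apply: ge0_le_integral => //.
    - by move=> w _; rewrite mule_ge0//; have /andP[] := f01 (bt w ++ tau :: rest).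
    - by apply: emeasurable_funM => //; exact: measurable_bt_cat.
    - by apply: emeasurable_funD => //; exact: emeasurable_funD.
    move=> w _ /=.
    have := IH (bt w ++ tau :: rest); rewrite all_cat bt0 stk0 => /(_ isT).
    rewrite -(fineK (ffin _)) -(fineK (gfin _)) -!EFinM -!EFinD lee_fin.
    by rewrite {1}/total_weight big_cat.
  rewrite -(fineK Ffin) -(fineK Gfin) -(fineK (ffin rest)) -(fineK (gfin rest)).
  rewrite -(fineK (ffin (tau :: rest))) -(fineK (gfin (tau :: rest))).
  rewrite -!EFinM -!EFinD lee_fin => hI [hg] [hf].
  have hrest := IH rest rest0.
  have := weight_drift tau.
  have W : total_weight (tau :: rest) = weight tau + total_weight rest.
    by rewrite /total_weight big_cons.
  have p0 : 0 <= expR (- (lam * tau)) := expR_ge0 _.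
  have p1 : 0 <= 1 - expR (- (lam * tau)).
    by rewrite subr_ge0 -expR0 ler_expR oppr_le0 mulr_ge0// ltW.
  move: hI hg hf p0 p1 hrest f1 g0; rewrite W -natr1.
  move: (expR (- _)) (fine (f (_ :: _))) (fine (g (_ :: _)))
    (fine (f rest)) (fine (g rest)).
  move: (fine (\int[P]_w f _)) (fine (\int[P]_w g _)).
  move: (weight tau) (total_weight rest) (j%:R : R) => w V J IF IG p F G Fr Gr.
  move=> hI hg hf p0 p1 hr F1 G0 hp.
  have JF : J * F = p * (J * Fr) + (1 - p) * (J * IF) by rewrite hf; ring.
  have JG : J * G = p * (J * Gr) + (1 - p) * (J * IG) by rewrite hg; ring.
  have := ler_wpM2l p0 hr; have := ler_wpM2l p1 hI; rewrite /=; lra.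
move=> stk stk0; rewrite -(fineK (ffin stk)) -(fineK (gfin stk)) lee_fin.
rewrite leNgt; apply/negP => gf.
(* A positive gap is impossible: some [j] makes [j] times the gap exceed the total weight. *)
have e0 : 0 < fine (f stk) - fine (g stk) by rewrite subr_gt0.
have := main (Num.truncn (total_weight stk / (fine (f stk) - fine (g stk)))).+1 _ stk0.
rewrite -lerBlDl -mulrBr -ler_pdivlMr// leNgt truncnS_gt//.
Qed.

Lemma safe_equation_unique a (f g : stack R -> \bar R) :
  measurable_fun setT f -> measurable_fun setT g ->
  (forall stk, 0 <= f stk <= 1)%E -> (forall stk, 0 <= g stk <= 1)%E ->
  safe_equation a f -> safe_equation a g -> f [::] = g [::] ->
  forall stk, all (>= 0) stk -> f stk = g stk.
Proof.
move=> mf mg f01 g01 ef eg fg0 stk stk0; apply/eqP; rewrite eq_le.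
by apply/andP; split; apply: (safe_equation_le a) => //; rewrite fg0.
Qed.

Variable u : R -> stack R -> \bar R.
Hypothesis mu : forall a, measurable_fun setT (u a).
Hypothesis u01 : forall a stk, (0 <= u a stk <= 1)%E.
Hypothesis eu : forall a, safe_equation a (u a).
Hypothesis u_nil : forall a, u a [::] = ((0 <= a)%R%:R)%:E.

(* The customers of [b] have to wait until those of [c] have left, after which the system
   starts afresh from [b]. *)
Lemma safe_cat a (b c : stack R) : (size b)%:R <= a -> all (>= 0) c ->
  u a (c ++ b) = (u (a - (size b)%:R)%R c * u a b)%E.
Proof.
move=> ba; pose a' := a - (size b)%:R.
pose f (c : stack R) := u a (c ++ b); pose g (c : stack R) := (u a' c * u a b)%E.
have u0 x stk : (0 <= u x stk)%E by have /andP[] := u01 x stk.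
apply: (safe_equation_unique a' f g).
- by apply: (measurableT_comp (mu a)); exact: measurable_stack_cat.
- by apply: emeasurable_funM => //; exact: mu.
- by move=> stk; exact: u01.
- move=> stk; rewrite mule_ge0//=.
  have /andP[_ h1] := u01 a' stk; have /andP[_ h2] := u01 a b.
  by rewrite -[leRHS]mule1 lee_pmul.
- move=> tau rest tau0; rewrite /f [LHS]eu//.
  (* The customers of [b] occupy [size b] places, so level [a] for [c ++ b] is level [a'] for [c]
     alone. *)
  rewrite size_cat -addSn natrD -lerBrDr.
  case: ifP => // _; congr (_ + _ * _)%E.
  by apply: eq_integral => w _; rewrite /f -catA.
- move=> tau rest tau0; rewrite /g eu//.
  case: ifP => _; last by rewrite mul0e.
  have p1 : 0 <= 1 - expR (- (lam * tau)).
    by rewrite subr_ge0 -expR0 ler_expR oppr_le0 mulr_ge0// ltW.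
  have I0 : (0 <= \int[P]_w u a' (bt w ++ tau :: rest : stack R))%E.
    exact: integral_ge0.
  rewrite ge0_muleDl ?mule_ge0 ?lee_fin ?expR_ge0// -!muleA.
  congr (_ + _ * _)%E; rewrite ge0_integralZr//.
  exact: measurable_bt_cat.
(* Boundary value: [size b <= a] makes [u a' [::]] equal to 1. *)
- by rewrite /f /g u_nil /a' subr_ge0 ba mul1e.
Qed.

(** [safe_cat] is used with the interrupting batch on top of the whole current stack. The unknown
    [u a (tau :: rest)] reappears on the right, just as [M(k,s)] stands on both sides of the
    distributional identity. *)
Lemma safe_cons_fixpoint a tau (rest : stack R) : all (>= 0) (tau :: rest) ->
  u a (tau :: rest) = (if ((size rest).+1%:R <= a)%R then
    (expR (- (lam * tau)))%:E * u a rest +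
    (1 - expR (- (lam * tau)))%:E *
      (\int[P]_w u (a - (size rest).+1%:R)%R (bt w) * u a (tau :: rest))
  else 0)%E.
Proof.
move=> /andP[tau0 rest0]; rewrite [LHS]eu//; case: ifP => // sa.
congr (_ + _ * _)%E.
rewrite -ge0_integralZr//; last 3 first.
- exact: (measurableT_comp (mu _) mbt).
- by move=> w _; have /andP[] := u01 (a - (size rest).+1%:R) (bt w).
- by have /andP[] := u01 a (tau :: rest).
by apply: eq_integral => w _; rewrite safe_cat.
Qed.

End comparison.

(** * Wald's identity for the mean of a random sum *)

Section wald.
Context {d : measure_display} {Omega : measurableType d} {R : realType}.
Variable P : probability Omega R.
Local Open Scope ereal_scope.

(** The random sum is a series of terms [Y i] restricted to [i < N]. Summation and integration
    commute by nonnegativity, and each term factors by independence. *)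
Lemma wald_identity (N : Omega -> nat) (Y : nat -> Omega -> R) (e : R) :
  measurable_fun setT N -> (forall i, measurable_fun setT (Y i)) ->
  (forall i w, (0 <= Y i w)%R) -> (forall i, independent2 P N (Y i)) ->
  (forall i, \int[P]_w (Y i w)%:E = e%:E) ->
  \int[P]_w (\sum_(i < N w) Y i w)%:E = e%:E * \int[P]_w ((N w)%:R)%:E.
Proof.
move=> mN mY Y0 ind eY.
have trunc (a : nat -> R) n : (forall i, 0 <= a i)%R ->
    (\sum_(i < n) a i)%:E = \sum_(0 <= i <oo) (if (i < n)%N then a i else 0%R)%:E.
  move=> a0; rewrite (nneseries_split _ n); last by move=> i _; case: ifP; rewrite ?lee_fin.
  rewrite add0n [X in _ + X]eseries0 ?adde0; last by move=> i /= ni _; rewrite ltnNge ni.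
  by rewrite big_mkord sumEFin; congr EFin; apply: eq_bigr => i _; rewrite ltn_ord.
have sum_int (a : nat -> Omega -> R) : (forall i, measurable_fun setT (a i)) ->
    (forall i w, (0 <= a i w)%R) ->
    \int[P]_w (\sum_(i < N w) a i w)%:E =
    \sum_(0 <= i <oo) \int[P]_w (if (i < N w)%N then a i w else 0%R)%:E.
  move=> ma a0; rewrite -integral_nneseries//.
  - by apply: eq_integral => w _; exact: (trunc (a ^~ w)).
  - move=> i; apply/measurable_EFinP; apply: measurable_fun_ifT => //.
    exact: measurable_fun_ltn.
  - by move=> i w _; case: ifP; rewrite ?lee_fin.
have intN : \int[P]_w ((N w)%:R)%:E =
    \sum_(0 <= i <oo) \int[P]_w (if (i < N w)%N then 1%R else 0%R)%:E.
  rewrite -(sum_int (fun _ _ => 1%R))//.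
  by apply: eq_integral => w _; rewrite sumr_const card_ord.
rewrite sum_int// intN -nneseriesZl; last first.
  by move=> i _; apply: integral_ge0 => w _; case: ifP; rewrite ?lee_fin.
apply: eq_eseriesr => i _.
(* The absolute value makes [g] nonnegative everywhere, as the product formula requires; it changes
   nothing because [Y i] is nonnegative. *)
pose g (v : nat * R) := (if (i < v.1)%N then `|v.2|%R else 0%R)%:E : \bar R.
have mg : measurable_fun setT g.
  apply/measurable_EFinP; apply: measurable_fun_ifT => //.
    by apply: measurable_fun_ltn => //; exact: measurable_fst.
  by apply: measurableT_comp => //; exact: measurable_snd.
transitivity (\int[P]_w g (N w, Y i w)).
  by apply: eq_integral => w _; rewrite /g/= ger0_norm.
rewrite independent2_ge0_integral//; last first.
  by move=> v; rewrite /g; case: ifP; rewrite lee_fin.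
rewrite -ge0_integralZl//; last 3 first.
- apply/measurable_EFinP; apply: measurable_fun_ifT => //.
  exact: measurable_fun_ltn.
- by move=> w _; case: ifP; rewrite lee_fin.
- by rewrite -(eY i); apply: integral_ge0 => w _; rewrite lee_fin.
apply: eq_integral => w _; rewrite /g/=; case: ifP => _; last by rewrite integral0 mule0.
by rewrite mule1 -(eY i); apply: eq_integral => w' _; rewrite ger0_norm.
Qed.

End wald.

(** * Distribution functions of the busy period maxima *)

Section model.
Context {R : realType} {d : measure_display} {Omega : measurableType d}.
Variables (P : probability Omega R) (lam mu : R)
  (T : nat -> Omega -> R) (B : nat -> Omega -> nat) (sig : nat -> nat -> Omega -> R).
Hypothesis hlam : 0 < lam.
Hypothesis hmeas : forall x, measurable_fun setT (inputs T B sig x).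
Hypothesis hind : mutually_independent P (inputs T B sig).
Hypothesis hT : forall n, (0 < n)%N -> forall t : R,
  P [set w | T n w <= t] = (if 0 <= t then 1 - expR (- (lam * t)) else 0)%:E.
Hypothesis hBid : forall n (A : set nat), P (B n @^-1` A) = P (B 0%N @^-1` A).
Hypothesis hBpos : P [set w | B 0%N w = 0%N] = 0%E.
Hypothesis hBmean : (\int[P]_w ((B 0%N w)%:R)%:E = mu%:E)%E.
Hypothesis hSid : forall n i (A : set R), measurable A ->
  P (sig n i @^-1` A) = P (sig 0%N 0%N @^-1` A).
Hypothesis hSpos : P [set w | sig 0%N 0%N w < 0] = 0%E.
Hypothesis hstab :
  (\int[P]_w (expR (lam * sig 0%N 0%N w))%:E < ((mu + 1) / mu)%:E)%E.

Let X := inputs T B sig.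
Let path w : paths input_idx R := X ^~ w.
Let u := safe_prob P X.

Let mT n : measurable_fun setT (T n.+1). Proof. exact: (hmeas (IT n)). Qed.
Let mB n : measurable_fun setT (B n).
Proof. by apply: (measurable_fun_natr (R := R)); exact: (hmeas (IB n)). Qed.
Let mS n i : measurable_fun setT (sig n i). Proof. exact: (hmeas (IS n i)). Qed.

Let eqdist_T n m : eqdist P (T n.+1) P (T m.+1).
Proof.
apply: (eqdist_ext _ _ _ _ (@RGenInftyO.G R) (RGenInftyO.measurableE R)) => //.
  move=> _ _ [x ->] [y ->]; exists (Order.min x y).
  by apply/seteqP; split => z /=; rewrite !in_itv/= lt_min => /andP.
move=> _ [t ->].
have ltE k : T k.+1 @^-1` `]-oo, t[%classic = [set w | T k.+1 w < t].
  by apply/seteqP; split => w /=; rewrite in_itv.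
rewrite !ltE (exponential_lt P lam (T n.+1))//; last by move=> x; exact: hT.
by rewrite (exponential_lt P lam (T m.+1))// => x; exact: hT.
Qed.

(** The law of an input depends only on its kind, so a renaming that respects kinds preserves
    marginals. *)
Let marginals s : (forall n, exists m, s (IT n) = IT m) ->
  (forall n, exists m, s (IB n) = IB m) ->
  (forall n i, exists m j, s (IS n i) = IS m j) -> same_marginals P X s id.
Proof.
move=> sT sB sS [n|n|n i] A mA.
- by have [m ->] := sT n; exact: eqdist_T.
- have [m ->] := sB n.
  rewrite (_ : X (IB m) @^-1` A = B m @^-1` [set k | A k%:R])// hBid.
  by rewrite (_ : X (id (IB n)) @^-1` A = B n @^-1` [set k | A k%:R])// [RHS]hBid.
- by have [m [j ->]] := sS n i; rewrite [LHS]hSid// [RHS]hSid.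
Qed.

Let stationary : same_marginals P X shift_idx id.
Proof. by apply: marginals => n *; do ?eexists. Qed.

Let memoryless (tau : R) (C : set R) : 0 <= tau -> measurable C ->
  P [set w | tau <= X (IT 0) w /\ C (X (IT 0) w - tau)] =
  (P [set w | (tau <= X (IT 0) w)%R] * P [set w | C (X (IT 0) w)])%E.
Proof. by apply: (exponential_memoryless _ lam) => // t; exact: hT. Qed.

Let nonneg_ae : {ae P, forall w n i, 0 <= sig n i w}.
Proof.
have sig0 n i : P [set w | sig n i w < 0] = 0%E.
  have ltE m j : [set w | sig m j w < 0] = sig m j @^-1` `]-oo, 0[%classic.
    by apply/seteqP; split => w /=; rewrite in_itv.
  by rewrite ltE hSid// -ltE.
have H n i : {ae P, forall w, 0 <= sig n i w}.
  exists [set w | sig n i w < 0]; split => //.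
    rewrite (_ : mkset _ = sig n i @^-1` `]-oo, 0[%classic).
      exact: preimage_measurable.
    by apply/seteqP; split => w /=; rewrite in_itv.
  by move=> w /= /negP; rewrite -ltNge.
have := ae_foralln (fun n => ae_foralln (H n)).
by apply: filterS => w h n i; exact: h.
Qed.

Let ae_integral (f g : Omega -> \bar R) :
  measurable_fun setT f -> measurable_fun setT g ->
  (forall w, (forall n i, 0 <= sig n i w) -> f w = g w) ->
  (\int[P]_w f w = \int[P]_w g w)%E.
Proof.
move=> mf mg fg; apply: ae_eq_integral => //.
by apply: filterS nonneg_ae => w h _; exact: fg.
Qed.

(* Negative service requirements are negligible; [S] makes them impossible. *)
Let S n i w := Order.max (sig n i w) 0.

Let measurable_S n i : measurable_fun setT (S n i).
Proof. exact: measurable_maxr. Qed.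

Let bt w : stack R := mkseq (fun i => S 0 i w) (B 0 w).

Let measurable_bt : measurable_fun setT bt.
Proof. exact: measurable_stack_mkseq. Qed.

Let mkseq_S_ge0 n f w : all (>= 0) (mkseq (fun i => S 0 (f i) w) n).
Proof. by apply/allP => _ /mapP[i _ ->]; rewrite /S le_max lexx orbT. Qed.

Let batch_ofE w : (forall n i, 0 <= sig n i w) -> batch_of (path w) = bt w.
Proof.
move=> h; rewrite /batch_of /bt /path /X/= natrK.
by apply: eq_map => i; rewrite /S max_l.
Qed.

Let measurable_u a : measurable_fun setT (u a).
Proof. exact: measurable_safe_prob. Qed.

Let u01 a stk : (0 <= u a stk <= 1)%E.
Proof. exact: safe_prob01. Qed.

(** First-step analysis with the exponential probabilities inserted; the actual batch is replaced by
    the almost surely equal [bt], whose services are all nonnegative. *)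
Let u_equation a : safe_equation P lam bt a (u a).
Proof.
move=> tau rest tau0; rewrite /u [LHS]safe_prob_cons//.
case: ifP => // _; congr (_ * _ + _ * _)%E.
- by rewrite (exponential_ge P lam (T 1))// => t; exact: hT.
- rewrite (exponential_lt P lam (T 1))// ?tau0// => t; exact: hT.
- apply: ae_integral => [| |w h]; last by rewrite -batch_ofE.
    apply: (measurableT_comp (measurable_u a)); apply: measurable_stack_cat => //.
    apply: (measurableT_comp measurable_batch_of); exact: measurable_path.
  by apply: (measurableT_comp (measurable_u a)); exact: measurable_stack_cat.
Qed.

(** Batches are almost surely nonempty. The bound makes [mu] positive, so the stability condition
    can be multiplied out. *)
Let mu_ge1 : 1 <= mu.
Proof.
rewrite -lee_fin -hBmean.
have -> : (1%:E = \int[P]_w (cst 1%:E w))%E.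
  by rewrite integral_cst// [X in (_ * X)%E](probability_setT P) mule1.
apply: ae_ge0_le_integral => //.
  exact/measurable_EFinP/measurable_fun_natr_cast.
exists [set w | B 0 w = 0%N]; split => //; first exact: (preimage_measurable (B 0) [set 0%N]).
move=> w /= h; apply: contrapT => Bw; apply: h => _.
by rewrite lee_fin ler1n lt0n; exact/eqP.
Qed.

Let independent_B_sig i (f : R -> R) : measurable_fun setT f ->
  independent2 P (B 0) (fun w => f (sig 0 i w)).
Proof.
move=> mf.
pose s (o : unit + unit) : input_idx := if o is inl _ then IB 0 else IS 0 i.
have s_inj : injective s by move=> [[]|[]] [[]|[]].
have iXs := mutually_independent_reindex P X s s_inj hind.
have ind := independent2_groups P (fun o => X (s o)) (fun o => hmeas (s o)) iXs.
have := independent2_comp P _ _ (fun y : paths unit R => Num.truncn (y tt))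
  (fun y : paths unit R => f (y tt)) _ _ ind.
rewrite (_ : _ \o _ = B 0); last by apply/funext => w; rewrite /= natrK.
apply.
  exact: (measurableT_comp measurable_truncn (measurable_coord tt)).
exact: (measurableT_comp mf (measurable_coord tt)).
Qed.

Let integral_sig i (f : R -> R) : measurable_fun setT f -> (forall x, 0 <= f x) ->
  (\int[P]_w (f (sig 0 i w))%:E = \int[P]_w (f (sig 0 0 w))%:E)%E.
Proof.
move=> mf f0.
have mEf : measurable_fun setT (EFin \o f) by exact/measurable_EFinP.
pose Z j : {mfun Omega >-> R} :=
  HB.pack (sig 0 j) (isMeasurableFun.Build _ _ _ _ _ (mS 0 j)).
have E j : (\int[P]_w (f (sig 0 j w))%:E = \int[distribution P (Z j)]_x (f x)%:E)%E.
  by rewrite ge0_integral_distribution// => x; rewrite lee_fin.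
by rewrite !E; apply: eq_measure_integral => A mA _; exact: hSid.
Qed.

(** With [m] the mean of [expR (lam * S)], Wald's identity turns the requirement into
    [mu * (m * (1 + K) - K) = K], a linear equation in [K]. *)
Let stack_weight :
  exists2 K, 0 <= K & (\int[P]_w (total_weight lam K (bt w))%:E = K%:E)%E.
Proof.
pose f (x : R) := expR (lam * Order.max x 0).
have mf : measurable_fun setT f.
  apply: (measurableT_comp (@measurable_expR R)); apply: measurable_funM => //.
  exact: measurable_maxr.
have f0 x : 0 <= f x by exact: expR_ge0.
have mexp : measurable_fun setT (fun w => expR (lam * sig 0 0 w)).
  by apply: (measurableT_comp (@measurable_expR R)); exact: measurable_funM.
have fE : (\int[P]_w (f (sig 0 0 w))%:E = \int[P]_w (expR (lam * sig 0 0 w))%:E)%E.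
  apply: ae_integral => [| |w h].
  - by apply/measurable_EFinP; exact: (measurableT_comp mf).
  - exact/measurable_EFinP.
  - by rewrite /f max_l.
pose M := (\int[P]_w (expR (lam * sig 0 0 w))%:E)%E.
have := hstab; rewrite -/M in fE * => hstabM.
have M0 : (0 <= M)%E by apply: integral_ge0 => w _; rewrite lee_fin expR_ge0.
have Mfin : M \is a fin_num by rewrite ge0_fin_numE// (lt_le_trans hstabM)// leey.
have mu0 : 0 < mu by exact: lt_le_trans mu_ge1.
pose m := fine M.
have m0 : 0 <= m by exact: fine_ge0.
have ME : M = m%:E by rewrite fineK.
have den : 0 < 1 - mu * (m - 1).
  by move: hstabM; rewrite ME lte_fin ltr_pdivlMr// => h; lra.
(* The solution of the linear equation; stability is exactly positivity of its denominator. *)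
pose K := mu * m / (1 - mu * (m - 1)).
have K0 : 0 <= K by rewrite divr_ge0 ?mulr_ge0// ltW.
exists K => //.
pose g (x : R) := weight lam K (Order.max x 0).
have mg : measurable_fun setT g.
  by apply: measurable_funB => //; exact: measurable_funM.
have g0 x : 0 <= g x.
  by apply: le_trans (weight_ge1 lam K hlam K0 _ _) => //; rewrite le_max lexx orbT.
have intg i : (\int[P]_w (g (sig 0 i w))%:E = (m * (1 + K) - K)%:E)%E.
  rewrite integral_sig//.
  have mgs : measurable_fun setT (fun w => (g (sig 0 0 w))%:E).
    by apply/measurable_EFinP; exact: (measurableT_comp mg).
  (* Adding [K] first keeps all integrands nonnegative and avoids integrating a difference. *)
  have : (\int[P]_w (g (sig 0 0 w))%:E + K%:E = (m * (1 + K))%:E)%E.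
    have {1}-> : (K%:E = \int[P]_w (cst K%:E w))%E.
      by rewrite integral_cst// [X in (_ * X)%E](probability_setT P) mule1.
    rewrite -ge0_integralD; [|by []|by move=> w _; rewrite lee_fin|exact: mgs|
      by move=> w _; rewrite lee_fin|by []].
    rewrite EFinM -ME -fE muleC -ge0_integralZl//.
    - by apply: eq_integral => w _ /=; rewrite -EFinD -EFinM /g /weight /f subrK mulrC.
    - by apply/measurable_EFinP; exact: (measurableT_comp mf).
    - by move=> w _; rewrite lee_fin.
    - by rewrite lee_fin addr_ge0.
  case: (integral _ _ _) => [r|//|//].
  by rewrite -EFinD => -[<-]; rewrite addrK.
transitivity (\int[P]_w (\sum_(i < B 0 w) g (sig 0 i w))%:E)%E.
  apply: eq_integral => w _; congr EFin.
  rewrite /total_weight /bt big_map.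
  by rewrite (_ : iota 0 _ = index_iota 0 (B 0 w)) ?big_mkord// /index_iota subn0.
rewrite (wald_identity P (B 0) (fun i w => g (sig 0 i w)) (m * (1 + K) - K))//.
- rewrite hBmean -EFinM; congr EFin; rewrite /K; field.
  by rewrite gt_eqF.
- by move=> i; exact: (measurableT_comp mg).
- by move=> i; exact: independent_B_sig.
Qed.

(** Only batches from 1 on must agree with the model, so the substitutions for [X_0] and [S_0] in
    batch 0 are all covered. *)
Let busy_event (B' : nat -> nat) (sig' : nat -> nat -> R) a w :
  (forall n, B' n.+1 = B n.+1 w) -> (forall n i, sig' n.+1 i = sig n.+1 i w) ->
  (busy_max (T ^~ w) B' sig' <= a%:E)%E <->
  safe a (push_batch B' sig' 0 : stack R, X (IT 0) w, shift (path w)).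
Proof. by move=> hB hS; apply: busy_max_le => // n; rewrite hB. Qed.

Let head w : paths (option nat) R := fun o => X (if o is Some i then IS 0 i else IB 0) w.

Let measurable_head : measurable_fun setT head.
Proof. by apply: measurable_fun_paths => i; exact: hmeas. Qed.

Let law_stack a (f : paths (option nat) R -> stack R) (g : Omega -> stack R) :
  measurable_fun setT f -> measurable_fun setT g ->
  (forall w, (forall n i, 0 <= sig n i w) -> f (head w) = g w) ->
  P [set w | safe a (f (head w), X (IT 0) w, shift (path w))] = (\int[P]_w u a (g w))%E.
Proof.
move=> mf mg fg; rewrite [LHS]safe_prob_stack//.
apply: ae_integral => [| |w h].
- apply: (measurableT_comp (measurable_u a)); apply: (measurableT_comp mf).
  exact: measurable_head.
- exact: (measurableT_comp (measurable_u a)).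
- by congr (u a _); exact: fg.
Qed.

Let law_M a : P [set w | (Mrv T B sig w <= a%:E)%E] = (\int[P]_w u a (bt w))%E.
Proof.
pose f (y : paths (option nat) R) : stack R :=
  mkseq (fun i => y (Some i)) (Num.truncn (y None)).
rewrite -(law_stack a f) //.
- congr (P _); apply/seteqP; split => w /=; rewrite busy_event// /push_batch /f/= natrK//.
- apply: (measurable_stack_mkseq (fun y : paths (option nat) R => Num.truncn (y None))
    (fun i y => y (Some i))) => [|i].
    exact: (measurableT_comp measurable_truncn (measurable_coord (None : option nat))).
  exact: (measurable_coord (Some i : option nat)).
Qed.

(** Indices start at 1 because customer 0, with the prescribed requirement [s], is in service. *)
Let waiting k w : stack R := mkseq (fun i => S 0 i.+1 w) k.

Let measurable_waiting k : measurable_fun setT (waiting k).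
Proof. exact: measurable_stack_mkseq. Qed.

Let push_head k s w : push_batch (setB0 (B ^~ w) k.+1)
  (setS0 (fun n i => sig n i w) s) 0 = s :: mkseq (fun i => sig 0 i.+1 w) k.
Proof.
rewrite /push_batch /setB0 /setS0/=; congr (_ :: _).
by rewrite (iotaDl 1 0) -map_comp.
Qed.

Let f_waiting k (y : paths (option nat) R) : stack R := mkseq (fun i => y (Some i.+1)) k.

Let measurable_f_waiting k : measurable_fun setT (f_waiting k).
Proof.
apply: (measurable_stack_mkseq (cst k)
  (fun i (y : paths (option nat) R) => y (Some i.+1))) => // i.
exact: (measurable_coord (Some i.+1 : option nat)).
Qed.

Let f_waitingE k w : (forall n i, 0 <= sig n i w) -> f_waiting k (head w) = waiting k w.
Proof. by move=> h; apply: eq_map => i; rewrite /S max_l. Qed.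

Let law_Mks a k s :
  P [set w | (Mks_rv T B sig k.+1 s w <= a%:E)%E] = (\int[P]_w u a (s :: waiting k w))%E.
Proof.
rewrite -(law_stack a (fun y => s :: f_waiting k y)).
- by congr (P _); apply/seteqP; split => w /=; rewrite busy_event// push_head.
- exact: measurable_stack_cons.
- exact: measurable_stack_cons.
- by move=> w h; rewrite f_waitingE.
Qed.

(** [M(k)] is built from customers [0] to [k - 1] of batch 0, while [waiting k] holds customers [1]
    to [k]; both give the same law because services are identically distributed. *)
Let law_Mk a k :
  P [set w | (Mk_rv T B sig k w <= a%:E)%E] = (\int[P]_w u a (waiting k w))%E.
Proof.
rewrite -(law_stack a (f_waiting k)) => [| | |w]; [|by []|by []|exact: f_waitingE].
(* Renames customer [i] of batch 0 to customer [i + 1] and leaves every other input in place. *)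
pose s (i : input_idx) : input_idx := if i is IS 0 i then IS 0 i.+1 else i.
have s_inj : injective s by move=> [n|n|[|n] i] [m|m|[|m] j] //= [] // ->.
have ss : same_marginals P X s id.
  apply: marginals => [n|n|[|n] i]; do ?eexists => //.
pose A := [set x : paths input_idx R |
  safe a (mkseq (fun i => x (IS 0 i)) k : stack R, x (IT 0), shift x)].
have mA : measurable A.
  apply: (preimage_measurable (fun x : paths input_idx R =>
    (mkseq (fun i => x (IS 0 i)) k : stack R, x (IT 0), shift x)) (safe a));
    last exact: measurable_safe.
  apply: measurable_fun_pair; last exact: measurable_shift.
  apply: measurable_fun_pair; last exact: measurable_coord.
  apply: (measurable_stack_mkseq (cst k)
    (fun i (x : paths input_idx R) => x (IS 0 i))) => // i.
  exact: measurable_coord.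
have shiftE w : shift (X ^~ w \o s : paths input_idx R) = shift (path w).
  by apply/funext => -[].
have := eqdist_reindex P X hmeas hind s id s_inj (@inj_id _) ss A mA.
rewrite (_ : P (_ @^-1` A) = P [set w |
    safe a (f_waiting k (head w), X (IT 0) w, shift (path w))]); last first.
  by congr (P _); apply/seteqP; split => w; rewrite /A /= shiftE.
move=> ->; congr (P _); apply/seteqP; split => w /=; rewrite busy_event//.
Qed.

Lemma measurable_Mks k s : measurable_fun setT (Mks_rv T B sig k.+1 s).
Proof.
apply: (measurability (@ErealGenOInfty.G R) (ErealGenOInfty.measurableE R)).
move=> _ [_ [a ->] <-]; rewrite setTI.
rewrite (_ : _ @^-1` _ = ~` [set w | (Mks_rv T B sig k.+1 s w <= a%:E)%E]); last first.
  by apply/seteqP; split => w /=; rewrite in_itv/= andbT ltNge => /negP.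
apply: measurableC.
rewrite (_ : mkset _ = [set w |
    safe a (s :: f_waiting k (head w), X (IT 0) w, shift (path w))]).
  apply: measurable_safe_event => //; apply: measurable_stack_cons => //.
  exact: (measurableT_comp (measurable_f_waiting k) measurable_head).
by apply/seteqP; split => w /=; rewrite busy_event// push_head.
Qed.

(** The fixed-point equation for [u], averaged over the waiting customers. The factor coming from
    the interrupting batch does not depend on them and leaves the integral as the law of [M]. *)
Lemma busy_max_recursion k s a : 0 <= s ->
  P [set w | (Mks_rv T B sig k.+1 s w <= a%:E)%E] = (if (k.+1%:R <= a)%R then
    (expR (- (lam * s)))%:E * P [set w | (Mk_rv T B sig k w <= a%:E)%E] +
    (1 - expR (- (lam * s)))%:E *
      (P [set w | (Mrv T B sig w <= (a - k.+1%:R)%:E)%E] *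
       P [set w | (Mks_rv T B sig k.+1 s w <= a%:E)%E])
  else 0)%E.
Proof.
move=> s0; have [K K0 KE] := stack_weight.
have u_nil x : u x [::] = ((0 <= x)%R%:R)%:E by exact: safe_prob_nil.
have bt0 w : all (>= 0) (bt w) by exact: (mkseq_S_ge0 _ id).
have waiting0 w : all (>= 0) (s :: waiting k w).
  by apply/andP; split => //; exact: (mkseq_S_ge0 k succn w).
have eq_u w := safe_cons_fixpoint P lam K bt hlam K0 measurable_bt bt0 KE u measurable_u
  u01 u_equation u_nil a s (waiting k w) (waiting0 w).
have mw : measurable_fun setT (fun w => u a (waiting k w)).
  exact: (measurableT_comp (measurable_u a) (measurable_waiting k)).
have msw : measurable_fun setT (fun w => u a (s :: waiting k w)).
  by apply: (measurableT_comp (measurable_u a)); exact: measurable_stack_cons.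
have p0 : (0 <= (expR (- (lam * s)))%:E)%E by rewrite lee_fin expR_ge0.
have p1 : (0 <= (1 - expR (- (lam * s)))%:E)%E.
  by rewrite lee_fin subr_ge0 -expR0 ler_expR oppr_le0 mulr_ge0// ltW.
have u0 x stk : (0 <= u x stk)%E by have /andP[] := u01 x stk.
rewrite law_Mks law_Mk law_M.
have I0 : (0 <= \int[P]_w u (a - k.+1%:R)%R (bt w))%E by exact: integral_ge0.
case: ifPn => ka; last first.
  by apply: integral0_eq => w _; rewrite eq_u size_mkseq (negbTE ka).
under [LHS]eq_integral => w _ do rewrite eq_u size_mkseq ka.
have mI : measurable_fun setT (fun w =>
    ((\int[P]_w u (a - k.+1%:R)%R (bt w)) * u a (s :: waiting k w))%E).
  exact: emeasurable_funM.
rewrite ge0_integralD; [|by []|by move=> w _; rewrite mule_ge0|exact: emeasurable_funM|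
  by move=> w _; rewrite mule_ge0// mule_ge0|exact: emeasurable_funM].
rewrite ge0_integralZl; [|by []|exact: mw|by []|by []].
rewrite ge0_integralZl; [|by []|exact: mI|by move=> w _; rewrite mule_ge0|by []].
rewrite ge0_integralZl; [by []|by []|exact: msw|by move=> w _|exact: I0].
Qed.

End model.

(** * Extended real laws determined by their values at real thresholds *)

Section extended_real_law.
Context {R : realType}.
Local Open Scope ereal_scope.

Lemma measurable_le_cst {d'} {O : measurableType d'} (X : O -> \bar R) (a : \bar R) :
  measurable_fun setT X -> measurable [set w | X w <= a].
Proof. by move=> mX; rewrite -[X in measurable X]setTI; exact: emeasurable_fun_infty_c. Qed.

(** Complements of the events with real thresholds are upper rays that contain [+oo]; these generate
    the sigma-algebra, so a possible mass at infinity is also determined. *)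
Lemma eqdist_le_ext {d1 d2} {O1 : measurableType d1} {O2 : measurableType d2}
    (P1 : probability O1 R) (X1 : O1 -> \bar R)
    (P2 : probability O2 R) (X2 : O2 -> \bar R) :
  measurable_fun setT X1 -> measurable_fun setT X2 ->
  (forall a : R, P1 [set w | X1 w <= a%:E] = P2 [set w | X2 w <= a%:E]) ->
  eqdist P1 X1 P2 X2.
Proof.
move=> m1 m2 H.
apply: (eqdist_ext _ _ _ _ (@ErealGenOInfty.G R) (ErealGenOInfty.measurableE R)) => //.
  move=> _ _ [x ->] [y ->]; exists (Order.max x y).
  apply/seteqP; split => z /=; rewrite !in_itv/= !andbT EFin_max gt_max.
    by move=> [-> ->].
  by move=> /andP.
move=> _ [a ->].
have gtE d (O : measurableType d) (X : O -> \bar R) :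
    X @^-1` `]a%:E, +oo[%classic = ~` [set w | X w <= a%:E].
  by apply/seteqP; split => w /=; rewrite in_itv/= andbT ltNge => /negP.
by rewrite !gtE !probability_setC ?H//; exact: measurable_le_cst.
Qed.

End extended_real_law.

(** * Distribution function of the right-hand side of the identity *)

Section mixture.
Context {R : realType} {d : measure_display} {Omega : measurableType d}.
Variable Q : probability Omega R.
Variables (I Ma Mb Mc : Omega -> \bar R).
Hypothesis mI : measurable_fun setT I.
Hypothesis mMa : measurable_fun setT Ma.
Hypothesis mMb : measurable_fun setT Mb.
Hypothesis mMc : measurable_fun setT Mc.
Hypothesis ind : mutually_independent Q (fun j : 'I_4 => nth I [:: I; Ma; Mb; Mc] j).
Local Open Scope ereal_scope.

Let indep4 (A0 A1 A2 A3 : set \bar R) :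
  measurable A0 -> measurable A1 -> measurable A2 -> measurable A3 ->
  Q (I @^-1` A0 `&` Ma @^-1` A1 `&` Mb @^-1` A2 `&` Mc @^-1` A3) =
  Q (I @^-1` A0) * Q (Ma @^-1` A1) * Q (Mb @^-1` A2) * Q (Mc @^-1` A3).
Proof.
move=> m0 m1 m2 m3.
have mA (j : 'I_4) : measurable (nth setT [:: A0; A1; A2; A3] j).
  by case: j => -[|[|[|[|//]]]].
have := ind (enum 'I_4) (fun j => nth setT [:: A0; A1; A2; A3] j) (enum_uniq _) mA.
rewrite big_enum/= !big_ord_recr big_ord0/= mul1e => <-.
congr (Q _); apply/seteqP; split => w /=.
  by move=> [[[h0 h1] h2] h3] [[|[|[|[|//]]]] j4] _.
move=> h; have H (j : nat) (j4 : (j < 4)%N) := h (Ordinal j4) (mem_enum _ (Ordinal j4)).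
by have := (H 0%N isT, H 1%N isT, H 2%N isT, H 3%N isT); move=> [[[]]].
Qed.

Lemma measurable_mixture (k : R) :
  measurable_fun setT (fun w => I w * Order.max (Ma w + k%:E) (Mb w)
    + (1 - I w) * Order.max k%:E (Mc w)).
Proof.
apply: emeasurable_funD; apply: emeasurable_funM => //.
- by apply: measurable_maxe => //; exact: emeasurable_funD.
- exact: emeasurable_funB.
- exact: measurable_maxe.
Qed.

(** Condition on the value of [I]: at 1 the event concerns [Ma] and [Mb], at 0 only [Mc] and the
    constant [k]. Independence factors both parts. *)
Lemma mixture_le (k a p q : R) : (p + q = 1)%R ->
  Q [set w | I w = 1] = q%:E -> Q [set w | I w = 0] = p%:E ->
  Q [set w | I w * Order.max (Ma w + k%:E) (Mb w)
     + (1 - I w) * Order.max k%:E (Mc w) <= a%:E] =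
  q%:E * (Q [set w | (Ma w <= (a - k)%R%:E)%E] * Q [set w | (Mb w <= a%:E)%E]) +
  p%:E * (if (k <= a)%R then Q [set w | (Mc w <= a%:E)%E] else 0).
Proof.
move=> pq Q1 Q0.
have mI1 : measurable [set w | I w = 1] by exact: (preimage_measurable I [set 1]).
have mI0 : measurable [set w | I w = 0] by exact: (preimage_measurable I [set 0]).
have dis : [set w | I w = 1] `&` [set w | I w = 0] = set0.
  by apply/seteqP; split => w //= -[-> /eqP]; rewrite onee_eq0.
pose D := [set w | I w = 1] `|` [set w | I w = 0].
have mD : measurable D by exact: measurableU.
have QD : Q D = 1 by rewrite measureU// [X in X + _]Q1 [X in _ + X]Q0 -EFinD addrC pq.
set E := [set w | _].
have mE : measurable E by apply: measurable_le_cst; exact: measurable_mixture.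
(* Only the law of [I] is known, so its values other than 0 and 1 are discarded as a null event. *)
have QnD : Q (E `\` D) = 0.
  have QC : Q (~` D) = 0 by rewrite probability_setC// QD subee.
  apply: (subset_measure0 _ _ _ QC); [exact: measurableD|exact: measurableC|by move=> w []].
rewrite (measureDI Q mE mD) [X in X + _]QnD add0e setIUr measureU//; first last.
- by rewrite setIACA setIid dis setI0.
- exact: measurableI.
- exact: measurableI.
congr (_ + _).
- have -> : E `&` [set w | I w = 1] = I @^-1` [set 1] `&`
     Ma @^-1` [set y | y <= (a - k)%R%:E] `&` Mb @^-1` [set y | y <= a%:E] `&`
     Mc @^-1` setT.
    apply/seteqP; split => w /=.
      (* The idle summand is 0 even where [Mc] is infinite, as 0 times infinity is 0 in the extended
         reals. *)
      move=> [+ I1]; rewrite /E/= I1 mul1e subee// mul0e adde0 ge_max => /andP[h1 h2].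
      by split => //; split => //; split => //; rewrite EFinB leeBrDr.
    move=> [[[I1 h1] h2] _]; split => //.
    by rewrite /E/= I1 mul1e subee// mul0e adde0 ge_max h2 andbT -leeBrDr// -EFinB.
  rewrite [LHS]indep4//; [|exact: measurable_le_cst|exact: measurable_le_cst].
  by rewrite preimage_setT probability_setT mule1 -muleA -Q1.
- case: ifPn => ka.
    have -> : E `&` [set w | I w = 0] = I @^-1` [set 0] `&`
       Ma @^-1` setT `&` Mb @^-1` setT `&` Mc @^-1` [set y | y <= a%:E].
      apply/seteqP; split => w /=.
        by move=> [+ I0]; rewrite /E/= I0 mul0e add0e sube0 mul1e ge_max => /andP[].
      move=> [[[I0 _] _] h]; split => //.
      by rewrite /E/= I0 mul0e add0e sube0 mul1e ge_max h lee_fin ka.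
    rewrite [LHS]indep4//; [|exact: measurable_le_cst].
    by rewrite !preimage_setT !probability_setT !mule1 -Q0.
  rewrite mule0 (_ : _ `&` _ = set0) ?measure0//.
  apply/seteqP; split => w //= -[+ I0].
  by rewrite /E/= I0 mul0e add0e sube0 mul1e ge_max lee_fin (negbTE ka).
Qed.

End mixture.

Theorem theorem5 (R : realType) (d : measure_display) (Omega : measurableType d)
  (P : probability Omega R) (lam mu : R)
  (T : nat -> Omega -> R) (B : nat -> Omega -> nat)
  (sig : nat -> nat -> Omega -> R)
  (hlam : 0 < lam)
  (hmeas : forall x, measurable_fun setT (inputs T B sig x))
  (hind : mutually_independent P (inputs T B sig))
  (hT : forall n, (0 < n)%N -> forall t : R,
     P [set w | T n w <= t] = (if 0 <= t then 1 - expR (- (lam * t)) else 0)%:E)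
  (hBid : forall n (A : set nat), P (B n @^-1` A) = P (B 0%N @^-1` A))
  (hBpos : P [set w | B 0%N w = 0%N] = 0%E)
  (hBmean : (\int[P]_w ((B 0%N w)%:R)%:E = mu%:E)%E)
  (hSid : forall n i (A : set R), measurable A ->
     P (sig n i @^-1` A) = P (sig 0%N 0%N @^-1` A))
  (hSpos : P [set w | sig 0%N 0%N w < 0] = 0%E)
  (hstab : (\int[P]_w (expR (lam * sig 0%N 0%N w))%:E < ((mu + 1) / mu)%:E)%E)
  (k : nat) (s : R) (hk : (1 <= k)%N) (hs : 0 <= s) :
  forall (d' : measure_display) (Omega' : measurableType d')
    (Q : probability Omega' R) (I Ma Mb Mc : Omega' -> \bar R),
    measurable_fun setT I -> measurable_fun setT Ma ->
    measurable_fun setT Mb -> measurable_fun setT Mc ->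
    mutually_independent Q (fun j : 'I_4 => nth I [:: I; Ma; Mb; Mc] j) ->
    eqdist Q I P (fun w => (if T 1%N w < s then 1 else 0)%:E) ->
    eqdist Q Ma P (Mrv T B sig) ->
    eqdist Q Mb P (Mks_rv T B sig k s) ->
    eqdist Q Mc P (Mk_rv T B sig k.-1) ->
    eqdist Q
      (fun w => I w * Order.max (Ma w + (k%:R)%:E) (Mb w)
              + (1 - I w) * Order.max ((k%:R)%:E) (Mc w))%E
      P (Mks_rv T B sig k s).

Proof.
move=> d' Omega' Q I Ma Mb Mc mI mMa mMb mMc ind eI eMa eMb eMc.
case: k hk => // {}k _ in eMb eMc *.
have mMks : measurable_fun setT (Mks_rv T B sig k.+1 s).
  exact: measurable_Mks.
apply: eqdist_le_ext => //; first exact: measurable_mixture.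
move=> a.
(* This equation is the distributional identity read at level [a]; it remains to recognize its terms
   in the law of the mixture. *)
have rec := busy_max_recursion P lam mu T B sig hlam hmeas hind hT hBid hBpos hBmean
  hSid hSpos hstab k s a hs.
pose p := expR (- (lam * s)).
have mT1 : measurable_fun setT (T 1) by exact: (hmeas (IT 0)).
have Q1 : Q [set w | I w = 1%E] = (1 - p)%:E.
  rewrite (_ : [set w | _] = I @^-1` [set 1%E])// eI//.
  rewrite (_ : _ @^-1` _ = [set w | T 1 w < s]).
    by rewrite (exponential_lt P lam)// ?hs// => t; exact: hT.
  by apply/seteqP; split => w /=; case: ifP => // _ [] /eqP; rewrite eq_sym oner_eq0.
have Q0 : Q [set w | I w = 0%E] = p%:E.
  rewrite (_ : [set w | _] = I @^-1` [set 0%E])// eI//.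
  rewrite (_ : _ @^-1` _ = [set w | s <= T 1 w]).
    by rewrite (exponential_ge P lam)// => t; exact: hT.
  by apply/seteqP; split => w /=; rewrite leNgt; case: ifP => // _ [] /eqP; rewrite oner_eq0.
rewrite (mixture_le Q I Ma Mb Mc mI mMa mMb mMc ind k.+1%:R a p (1 - p))//;
  last by rewrite addrC subrK.
rewrite (_ : Q [set w | (Ma w <= (a - k.+1%:R)%:E)%E] =
  P [set w | (Mrv T B sig w <= (a - k.+1%:R)%:E)%E]); last first.
  by apply: (eMa [set y | (y <= (a - k.+1%:R)%:E)%E]); exact: measurable_le_cst.
rewrite (_ : Q [set w | (Mb w <= a%:E)%E] =
  P [set w | (Mks_rv T B sig k.+1 s w <= a%:E)%E]); last first.
  by apply: (eMb [set y | (y <= a%:E)%E]); exact: measurable_le_cst.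
rewrite (_ : Q [set w | (Mc w <= a%:E)%E] =
  P [set w | (Mk_rv T B sig k w <= a%:E)%E]); last first.
  by apply: (eMc [set y | (y <= a%:E)%E]); exact: measurable_le_cst.
move: rec; case: ifP => ka rec; first by rewrite addeC -rec.
(* Below level [k + 1] the probability for [M(k+1,s)] is itself 0, so the interruption term vanishes
   as well. *)
by rewrite rec !mule0 adde0.
Qed.
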